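(* Let $(\mathfrak{L}^{n+1},\mathfrak{g})$ be an $(n+1)$-dimensional spacetime of class $\mathcal{S}$. The lift of the future (or past) null bundle over any maximal spherically symmetric photon surface in $\mathfrak{L}^{n+1}$ is a smooth submanifold of phase space $T^*\mathfrak{L}^{n+1}$ and has topology $T^1\mathbb{S}^{n-1}\times\mathbb{R}^2$, where $T^1\mathbb{S}^{n-1}$ is the unit tangent bundle over $\mathbb{S}^{n-1}$. The lift of the future (or past) null bundle over any maximal principal null hypersurface to phase space is a smooth submanifold and has topology $\mathbb{S}^{n-1}\times\mathbb{R}^2$.
   Context: Class $\mathcal{S}$: spacetimes $\mathfrak{L}^{n+1}=\mathbb{R}\times\mathcal{I}\times\mathbb{S}^{n-1}$, $\mathfrak{g}=-f(r)dt^2+\frac{1}{f(r)}dr^2+r^2\Omega$, with $\mathcal{I}\subseteq(0,\infty)$ an open interval, $f\colon\mathcal{I}\to(0,\infty)$ smooth, $\Omega$ the round metric on $\mathbb{S}^{n-1}$, time-oriented by $\partial_t$. Photon surface: a timelike hypersurface $P^n$ such that every null geodesic initially tangent to $P^n$ remains tangent as long as it exists (equivalently, $P^n$ is totally umbilic). It is spherically symmetric if it is connected and each non-empty intersection $P^n\cap\{t=t_0\}$ equals $\{t_0\}\times\{r_0\}\times\mathbb{S}^{n-1}$ for some $r_0\in\mathcal{I}$. A connected spherically symmetric photon surface is maximal if it is not a subset of a strictly larger connected spherically symmetric photon surface. A null geodesic $\gamma(s)=(t(s),r(s),\xi(s))$ generates the hypersurface $H_\gamma=\{(t(s),r(s),\xi_*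 )\mid s\in J,\ \xi_*\in\mathbb{S}^{n-1}\}$. A null geodesic is principal if its angular momentum vanishes (i.e. $\xi$ is constant); the hypersurfaces generated by principal null geodesics are the principal null hypersurfaces, and they are maximal if the generating null geodesic is maximally extended. The future (past) null bundle over a hypersurface $P^n$ is the set of future (past) directed non-zero null vectors tangent to $P^n$; its (canonical) lift to phase space is its image in $T^*\mathfrak{L}^{n+1}$ under the metric isomorphism $X\mapsto\mathfrak{g}(X,\cdot)$. *)

(* Defs.v *)
From HB Require Import structures.
From mathcomp Require Import all_boot all_order all_algebra.
From mathcomp Require Import all_classical all_reals all_analysis.
Set Implicit Arguments.
Unset Strict Implicit.
Unset Printing Implicit Defensive.
Import Order.TTheory GRing.Theory Num.Theory.
Import numFieldNormedType.Exports.
Local Open Scope classical_set_scope.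
Local Open Scope ring_scope.

(* All manifolds are subsets of finite-dimensional normed spaces. *)

Section SmoothCalculus.
Variable R : realType.

(* [U] is meant to be open. In finite dimension, [f] is C^(k+1) on [U] iff it
   is differentiable there and all its directional derivatives are C^k. *)
Fixpoint Ck (V W : normedModType R) (k : nat) (U : set V) (f : V -> W) : Prop :=
  match k with
  | 0 => forall x, U x -> {for x, continuous f}
  | k'.+1 => (forall x, U x -> differentiable f x) /\
             forall v : V, Ck k' U (fun x => 'D_v f x)
  end.

Definition smooth_on (V W : normedModType R) (U : set V) (f : V -> W) : Prop :=
  forall k, Ck k U f.

(* Milnor's definition: every point of [S] has a neighbourhood in [S] which is
   diffeomorphic to an open subset of R^k, a map on a subset of [V] being
   smooth when it extends smoothly to an open set. This describes the embedded
   submanifolds of [V]. *)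
Definition smooth_manifold (V : normedModType R) (k : nat) (S : set V) : Prop :=
  forall p, S p -> exists (U : set V) (D : set 'rV[R]_k)
                          (phi : 'rV[R]_k -> V) (psi : V -> 'rV[R]_k),
    [/\ open U, U p & open D] /\
    [/\ smooth_on D phi, smooth_on U psi,
        forall x, D x -> (S `&` U) (phi x) /\ psi (phi x) = x &
        forall q, (S `&` U) q -> D (psi q) /\ phi (psi q) = q].

(* When [M] is itself embedded in [V], a subset of [M] is an embedded
   submanifold of [M] iff it is one of [V]. *)
Definition smooth_submanifold (V : normedModType R) (M : set V) (k : nat)
    (S : set V) : Prop :=
  S `<=` M /\ smooth_manifold k S.

(* Tangent vectors as velocities of smooth curves in [S]. *)
Definition tangent (V : normedModType R) (S : set V) (p v : V) : Prop :=
  exists (e : R) (c : R -> V),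
    [/\ 0 < e, smooth_on (ball (0 : R) e) c,
        forall s, ball (0 : R) e s -> S (c s), c 0 = p & derive1 c 0 = v].

Definition homeomorphic (V W : topologicalType) (A : set V) (B : set W) : Prop :=
  exists (h : V -> W) (k : W -> V),
    [/\ {within A, continuous h}, {within B, continuous k},
        forall x, A x -> B (h x) /\ k (h x) = x &
        forall y, B y -> A (k y) /\ h (k y) = y].

End SmoothCalculus.

(* The elements are points (t, r, xi) or vectors at such points. *)
Notation ambient R n := (R * R * 'rV[R]_n)%type.

Section Spacetime.
Variables (R : realType) (n : nat).
Local Notation E := (ambient R n).

(* The norm of the library on row vectors is the sup norm, hence an explicit
   Euclidean product. *)
Definition dot (u v : 'rV[R]_n) : R := \sum_(i < n) u 0 i * v 0 i.

(* S^(n-1) *)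
Definition sphere : set 'rV[R]_n := [set x | dot x x = 1].

(* T^1 S^(n-1) *)
Definition unit_tangent_sphere : set ('rV[R]_n * 'rV[R]_n) :=
  [set z | [/\ sphere z.1, tangent sphere z.1 z.2 & dot z.2 z.2 = 1]].

Definition tc (p : E) : R := p.1.1.
Definition rc (p : E) : R := p.1.2.
Definition xic (p : E) : 'rV[R]_n := p.2.
Definition mkpt (t r : R) (xi : 'rV[R]_n) : E := ((t, r), xi).

Definition classS (I : set R) (f : R -> R) : Prop :=
  [/\ open I, is_interval I, (forall r, I r -> 0 < r),
      smooth_on I f & (forall r, I r -> 0 < f r)].

Section ClassS.
Variables (I : set R) (f : R -> R).

Definition spacetime : set E := [set p | I (rc p) /\ sphere (xic p)].

(* The formula extends the metric from [spacetime] to the open set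
   R x I x R^n. *)
Definition metric (p v w : E) : R :=
  - f (rc p) * (tc v * tc w) + (f (rc p))^-1 * (rc v * rc w)
  + rc p ^+ 2 * dot (xic v) (xic w).

Definition dt : E := mkpt 1 0 0.

Definition null_vector (p v : E) : Prop := v <> 0 /\ metric p v v = 0.
Definition future_directed (p v : E) : Prop := metric p v dt < 0.
Definition past_directed (p v : E) : Prop := 0 < metric p v dt.

(* For c = gamma s, v = gamma' s and a constant vector field w of the ambient
   space, the Koszul formula for the Levi-Civita connection reads
   g_c(Dv/ds, w) = d/ds g_c(v, w) - 1/2 (w . g)_c(v, v). The connection of
   [spacetime] being the tangential part of that of R x I x R^n, a curve in
   [spacetime] is a geodesic iff this vanishes for all w tangent to
   [spacetime]. *)
Definition geodesic (J : set R) (gamma : R -> E) : Prop :=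
  [/\ open J, is_interval J, J !=set0, smooth_on J gamma &
      (forall s, J s -> spacetime (gamma s)) /\
      forall s w, J s -> tangent spacetime (gamma s) w ->
        derive1 (fun u : R => metric (gamma u) (derive1 gamma u) w) s =
        2^-1 * 'D_w (fun q : E => metric q (derive1 gamma s) (derive1 gamma s)) (gamma s)].

Definition null_geodesic (J : set R) (gamma : R -> E) : Prop :=
  geodesic J gamma /\ forall s, J s -> null_vector (gamma s) (derive1 gamma s).

Definition angular_momentum (gamma : R -> E) (s : R) : R :=
  rc (gamma s) ^+ 2 *
  Num.sqrt (dot (xic (derive1 gamma s)) (xic (derive1 gamma s))).

Definition principal_null_geodesic (J : set R) (gamma : R -> E) : Prop :=
  null_geodesic J gamma /\ forall s, J s -> angular_momentum gamma s = 0.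

Definition maximally_extended (J : set R) (gamma : R -> E) : Prop :=
  geodesic J gamma /\
  forall J' gamma', geodesic J' gamma' -> J `<=` J' ->
    (forall s, J s -> gamma' s = gamma s) -> J' = J.

Definition generated_hypersurface (J : set R) (gamma : R -> E) : set E :=
  [set p | exists s xi,
     [/\ J s, sphere xi & p = mkpt (tc (gamma s)) (rc (gamma s)) xi]].

Definition maximal_principal_null_hypersurface (H : set E) : Prop :=
  exists J gamma, [/\ principal_null_geodesic J gamma,
    maximally_extended J gamma & H = generated_hypersurface J gamma].

(* The metric induced on the tangent spaces is Lorentzian: some tangent [v] is
   timelike and the metric is positive definite on its orthogonal
   complement. *)
Definition timelike_hypersurface (P : set E) : Prop :=
  smooth_submanifold spacetime n P /\
  forall p, P p -> exists v, [/\ tangent P p v, metric p v v < 0 &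
    forall w, tangent P p w -> metric p v w = 0 -> w <> 0 ->
      0 < metric p w w].

Definition tangent_at (P : set E) (gamma : R -> E) (s : R) : Prop :=
  P (gamma s) /\ tangent P (gamma s) (derive1 gamma s).

(* A null geodesic of [spacetime] tangent to [P] may run across the edge of
   [P], as for any proper open piece of a larger photon surface. Remaining
   tangent is therefore required locally in the parameter, which is what makes
   the notion equivalent to total umbilicity. *)
Definition photon_surface (P : set E) : Prop :=
  timelike_hypersurface P /\
  forall J gamma, null_geodesic J gamma ->
    forall s0, J s0 -> tangent_at P gamma s0 ->
      \forall s \near s0, J s -> tangent_at P gamma s.

Definition sph_sym_photon_surface (P : set E) : Prop :=
  [/\ photon_surface P, P !=set0, connected P &
      forall t0, P `&` [set p | tc p = t0] !=set0 ->
        exists2 r0, I r0 & P `&` [set p | tc p = t0] =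
          [set p | [/\ tc p = t0, rc p = r0 & sphere (xic p)]]].

Definition maximal_sph_sym_photon_surface (P : set E) : Prop :=
  sph_sym_photon_surface P /\
  forall Q, sph_sym_photon_surface Q -> P `<=` Q -> Q = P.

Definition future_null_bundle (P : set E) : set (E * E) :=
  [set z | [/\ P z.1, tangent P z.1 z.2, null_vector z.1 z.2 &
               future_directed z.1 z.2]].

Definition past_null_bundle (P : set E) : set (E * E) :=
  [set z | [/\ P z.1, tangent P z.1 z.2, null_vector z.1 z.2 &
               past_directed z.1 z.2]].

Definition pairing (a w : E) : R :=
  tc a * tc w + rc a * rc w + dot (xic a) (xic w).

(* A covector alpha at p is encoded by the unique a tangent to [spacetime] at p
   with alpha = [pairing a]. *)
Definition phase_space : set (E * E) :=
  [set z | spacetime z.1 /\ tangent spacetime z.1 z.2].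

(* Image under X |-> g(X, .) *)
Definition cotangent_lift (N : set (E * E)) : set (E * E) :=
  [set z | phase_space z /\
     exists X, N (z.1, X) /\
       forall w, tangent spacetime z.1 w -> pairing z.2 w = metric z.1 X w].

End ClassS.
End Spacetime.
Arguments sphere : clear implicits.
Arguments unit_tangent_sphere : clear implicits.
Arguments phase_space {R} n I _.

(* Main.v *)
(* A curve with timelike velocity in a spherically symmetric hypersurface [P]
   moves in [t], so [P] is a surface of rotation [r = rho t] over an open
   interval [T], and [rho' ^ 2 < f(rho) ^ 2] there. A principal null geodesic
   generates such a surface with [rho' ^ 2 = f(rho) ^ 2]. A vector tangent to a
   surface of rotation at [(t, rho t, xi)] is [(tau, tau rho', eta)] with [eta]
   orthogonal to [xi], and it is null iff
   [rho ^ 2 |eta| ^ 2 = tau ^ 2 (f - rho' ^ 2 / f)]. In the timelike case [eta] is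
   a nonzero multiple of a unit tangent vector of the sphere, the factor being
   determined by [t] and [tau]; in the null case [eta = 0]. Hence the lift is
   diffeomorphic to [T^1 S^(n-1) * (T * ]0, +oo[)], resp.
   [S^(n-1) * (T * ]0, +oo[)], the last factor being the energy. *)
Require Import Defs.
From HB Require Import structures.
From mathcomp Require Import all_boot all_order all_algebra.
From mathcomp Require Import all_classical all_reals all_analysis.
From mathcomp Require Import ring lra.
Set Implicit Arguments.
Unset Strict Implicit.
Unset Printing Implicit Defensive.
Import Order.TTheory GRing.Theory Num.Theory.
Import numFieldNormedType.Exports.
Local Open Scope classical_set_scope.
Local Open Scope ring_scope.

(** * Differential calculus of class C^k *)

(** The definition of a spherically symmetric photon surface fixes the radius at each time
    separately, so [rho] starts as a choice function without regularity; a principal null geodesic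
    gives [r] as a function of its own parameter, not of [t]. In both cases smoothness comes from
    reparametrising a smooth curve by its [t]-coordinate, whose derivative cannot vanish: a vector
    with zero [t]-component has nonnegative square, and a null vector with neither angular part nor
    [t]-component is zero. This takes only a one-variable inverse function theorem, obtained from
    Rolle's theorem, and it also shows that [T] is open. The submanifold and topology claims are
    read off one explicit map, whose two directions are smooth on open sets of the ambient vector
    spaces. That the model [T^1 S^(n-1)] is a manifold follows from stereographic charts, over which
    this bundle is trivial. The factor R^2 appears because [T] and []0, +oo[] are nonempty open
    intervals, hence diffeomorphic to the line, here by algebraic functions. *)

Section Calculus.
Variable R : realType.
Implicit Types V W Z : normedModType R.

Definition findim V := exists (J : finType) (e : J -> V) (l : J -> {linear V -> R^o}),
  (forall i, continuous (l i : V -> R)) /\ forall w, w = \sum_i l i w *: e i.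

Lemma Ck_continuous V W k (U : set V) (f : V -> W) x :
  Ck k U f -> U x -> {for x, continuous f}.
Proof.
case: k => [|k] /=; first exact.
by move=> [df _] Ux; apply: differentiable_continuous; exact: df.
Qed.

Lemma CkW V W k (U : set V) (f : V -> W) : Ck k.+1 U f -> Ck k U f.
Proof.
elim: k f => [|k IH] f Cf; first by move=> x Ux; exact: (Ck_continuous Cf).
have [df Df] := Cf.
by split => // v; apply: IH; exact: Df.
Qed.

Lemma near_eq_differentiable V W (f g : V -> W) x :
  (\near x, f x = g x) -> differentiable f x -> differentiable g x.
Proof.
move=> fg df.
(* The first-order expansion of [f] at [x] is also one of [g], and uniqueness of such expansions
   identifies the differential. *)
have E : g \o shift x = cst (g x) + 'd f x +o_ 0 id.
  have /diff_locally/eqaddoP H := df.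
  apply/eqaddoP => e e0; have He := H e e0.
  have := fg; rewrite (near_shift 0) /= subr0 => fg0.
  apply: filterS2 fg0 He => y /=; rewrite !fctE/= => <-.
  by rewrite (nbhs_singleton fg).
have dE := diff_unique (diff_continuous df) E.
by apply/diff_locallyP; rewrite dE; split => //; exact: diff_continuous.
Qed.

(** A derivative at a point depends only on the germ there, so ['D_v f] and ['D_v g] again agree on
    the same open set and the induction continues. This allows a derivative to be replaced by a
    formula for it. *)
Lemma Ck_local V W k (U : set V) (f : V -> W) :
  (forall x, U x -> exists (O : set V) (g : V -> W),
     [/\ open O, O x, Ck k O g & forall y, O y -> f y = g y]) -> Ck k U f.
Proof.
elim: k U f => [|k IH] U f H.
  move=> x /H [B [g [oB Bx Cg fg]]].
  have nfg : \near x, f x = g x.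
    by apply: filterS (open_nbhs_nbhs (conj oB Bx)).
  rewrite /prop_for /continuous_at (nbhs_singleton nfg).
  apply: cvg_trans (Cg _ Bx); apply: near_eq_cvg.
  by apply: filterS nfg.
split=> [x|v].
  move=> /H [B [g [oB Bx [Cg _] fg]]].
  apply: (@near_eq_differentiable _ _ g); last exact: Cg.
  by apply: filterS (open_nbhs_nbhs (conj oB Bx)) => y /fg.
apply: IH => x /H [B [g [oB Bx [_ Cg] fg]]].
exists B, (fun x => 'D_v g x); split=> [//|//||y By]; first exact: Cg.
apply: near_eq_derive.
by apply: filterS (open_nbhs_nbhs (conj oB By)) => z /fg.
Qed.

Lemma Ck_eq V W k (U : set V) (f g : V -> W) : open U ->
  (forall x, U x -> f x = g x) -> Ck k U g -> Ck k U f.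
Proof. by move=> oU fg Cg; apply: Ck_local => x Ux; exists U, g. Qed.

Lemma CkS V W k (U O : set V) (f : V -> W) : U `<=` O -> Ck k O f -> Ck k U f.
Proof.
elim: k f => [|k IH] f UO; first by move=> Cf x /UO; exact: Cf.
by move=> [df Df]; split=> [x /UO|v]; [exact: df|exact: IH (Df v)].
Qed.

Lemma Ck_cst V W k (U : set V) (w : W) : Ck k U (fun=> w : W).
Proof.
elim: k w => [|k IH] w; first by move=> x _; exact: cst_continuous.
split=> [x _|v]; first exact: differentiable_cst.
have -> : (fun x => 'D_v (fun=> w) x) = fun=> 0 :> W.
  by apply/funext => x; exact: derive_cst.
exact: IH.
Qed.

Lemma CkD V W k (U : set V) (f g : V -> W) :
  Ck k U f -> Ck k U g -> open U -> Ck k U (fun x => f x + g x).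
Proof.
move=> + + oU.
elim: k f g => [|k IH] f g.
  by move=> cf cg x Ux; apply: cvgD; [exact: cf|exact: cg].
move=> [df Df] [dg Dg]; split=> [x Ux|v].
  by apply: differentiableD; [exact: df|exact: dg].
apply: (@Ck_eq _ _ _ _ _ (fun x => 'D_v f x + 'D_v g x)) => //; last first.
  by apply: IH; [exact: Df|exact: Dg].
move=> x Ux; apply: deriveD; apply: diff_derivable; [exact: df|exact: dg].
Qed.

Lemma Ck_lin V W k (U : set V) (f : {linear V -> W}) :
  continuous f -> Ck k U f.
Proof.
move=> cf; case: k => [|k]; first by move=> x _; exact: cf.
split=> [x _|v]; first exact: linear_differentiable.
have -> : (fun x => 'D_v f x) = fun=> f v.
  apply/funext => x; rewrite deriveE ?diff_lin//; exact: linear_differentiable.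
exact: Ck_cst.
Qed.

Lemma Ck_linl V W Z k (U : set V) (h : {linear W -> Z}) (f : V -> W) :
  continuous h -> open U -> Ck k U f -> Ck k U (fun x => h (f x)).
Proof.
move=> ch oU; elim: k f => [|k IH] f.
  by move=> cf x Ux; apply: continuous_comp; [exact: cf|exact: ch].
move=> [df Df]; split=> [x Ux|v].
  apply: (@differentiable_comp _ _ _ _ f h); [exact: df|exact: linear_differentiable].
apply: (@Ck_eq _ _ _ _ _ (fun x => h ('D_v f x))) => //; last by apply: IH; exact: Df.
move=> x Ux.
have dh := @linear_differentiable _ _ _ h (f x) ch.
rewrite deriveE; last by apply: (@differentiable_comp _ _ _ _ f h) => //; exact: df.
rewrite (@diff_comp _ _ _ _ f h)//; last exact: df.
by rewrite /= diff_lin// deriveE //; exact: df.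
Qed.

End Calculus.

(** * Leibniz rule and chain rule for C^k maps *)

Section Composition.
Variable R : realType.
Implicit Types V W Z : normedModType R.

Lemma differentiable_scale V W (a : V -> R) (g : V -> W) x :
  differentiable a x -> differentiable g x ->
  differentiable (fun y => a y *: g y) x /\
  forall v, 'D_v (fun y => a y *: g y) x = 'D_v a x *: g x + a x *: 'D_v g x.
Proof.
move=> da dg.
(* Scaling is packed as a continuous bilinear map, whose known differential is the Leibniz rule. *)
have bl : bilinear_for (GRing.Scale.Law.clone _ _ *:%R _)
    (GRing.Scale.Law.clone _ _ *:%R _) (fun (r : R^o) (w : W) => r *: w).
  split=> [w|r] b u v /=; first by rewrite scalerDl scalerA.
  by rewrite scalerDr !scalerA mulrC.
pose blM := bilinear_isBilinear.Build R R^o W W _ _ _ bl.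
pose B : {bilinear R -> W -> W} := HB.pack (fun (r : R) (w : W) => r *: w) blM.
have cB : continuous (fun p : R * W => B p.1 p.2) by exact: scale_continuous.
have dp := differentiable_pair da dg.
have dB := differentiable_bilin (a x, g x) cB.
have dS : differentiable (fun y => a y *: g y) x.
  exact: (@differentiable_comp _ _ _ _ (fun y => (a y, g y))
    (fun p : R * W => p.1 *: p.2)).
split=> // v.
rewrite deriveE// (@diff_comp _ _ _ _ (fun y => (a y, g y))
    (fun p : R * W => p.1 *: p.2))//=.
by rewrite (@diff_bilin _ _ _ _ B)//= diff_pair//= !deriveE// addrC.
Qed.

Lemma CkZ V W k (U : set V) (a : V -> R) (g : V -> W) : open U ->
  Ck k U a -> Ck k U g -> Ck k U (fun x => a x *: g x).
Proof.
move=> oU; elim: k a g => [|k IH] a g.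
  by move=> ca cg x Ux; apply: cvgZ; [exact: ca|exact: cg].
move=> Ca Cg; have [da Da] := Ca; have [dg Dg] := Cg; split=> [x Ux|v].
  exact: (differentiable_scale (da _ Ux) (dg _ Ux)).1.
apply: (@Ck_eq _ _ _ _ _ _ (fun x => 'D_v a x *: g x + a x *: 'D_v g x)) => //.
  by move=> x Ux; exact: (differentiable_scale (da _ Ux) (dg _ Ux)).2.
by apply: CkD => //; apply: IH => //; [exact: Da|exact: CkW|exact: CkW|exact: Dg].
Qed.

Lemma Ck_sum V W k (U : set V) (J : Type) (r : seq J) (F : J -> V -> W) : open U ->
  (forall j, Ck k U (F j)) -> Ck k U (fun x => \sum_(j <- r) F j x).
Proof.
move=> oU CF; elim: r => [|j r IH].
  have -> : (fun x => \sum_(j <- [::]) F j x) = fun=> 0.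
    by apply/funext => x; rewrite big_nil.
  exact: Ck_cst.
have -> : (fun x => \sum_(i <- j :: r) F i x)
    = fun x => F j x + \sum_(i <- r) F i x.
  by apply/funext => x; rewrite big_cons.
by apply: CkD.
Qed.

Lemma derive_lin V W Z (h : {linear W -> Z}) (f : V -> W) x v :
  continuous h -> differentiable f x ->
  'D_v (fun y => h (f y)) x = h ('D_v f x).
Proof.
move=> ch df.
have dh := @linear_differentiable _ _ _ h (f x) ch.
rewrite deriveE; last by apply: (@differentiable_comp _ _ _ _ f h).
by rewrite (@diff_comp _ _ _ _ f h)//= diff_lin// deriveE.
Qed.

(** The derivative of the composite at [x] is that of [g] in the direction ['D_v f x], which moves
    with [x], while [Ck] speaks of fixed directions only. Expanding it on the spanning family of [W]
    gives a finite sum of products to which the induction applies. *)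
Lemma Ck_comp V W Z k (U : set V) (O : set W) (f : V -> W) (g : W -> Z) :
  findim W -> open U -> open O -> (forall x, U x -> O (f x)) ->
  Ck k U f -> Ck k O g -> Ck k U (fun x => g (f x)).
Proof.
move=> [m [e [l [cl le]]]] oU oO UO.
elim: k f g UO => [|k IH] f g UO.
  move=> cf cg x Ux; apply: (@continuous_comp _ _ _ f g); first exact: cf.
  by apply: cg; exact: UO.
move=> Cf Cg; have [df Df] := Cf; have [dg Dg] := Cg.
split=> [x Ux|v].
  apply: (@differentiable_comp _ _ _ _ f g); first exact: df.
  by apply: dg; exact: UO.
apply: (@Ck_eq _ _ _ _ _ _
    (fun x => \sum_i l i ('D_v f x) *: 'D_(e i) g (f x))) => //.
  move=> x Ux.
  have dfx := df _ Ux; have dgx := dg _ (UO _ Ux).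
  rewrite deriveE; last exact: (@differentiable_comp _ _ _ _ f g).
  rewrite (@diff_comp _ _ _ _ f g)//= -(@deriveE _ _ _ f x v)//.
  rewrite [LHS](congr1 ('d g (f x)) (le ('D_v f x))) linear_sum.
  by apply: eq_bigr => i _; rewrite linearZ -deriveE.
apply: Ck_sum => // i; apply: CkZ => //.
  by apply: (@Ck_linl _ _ _ _ _ _ (l i)) => //; exact: Df.
by apply: (IH f (fun y => 'D_(e i) g y)) => //; [exact: CkW|exact: Dg].
Qed.

Lemma findim_lin_continuous V W (f : {linear V -> W}) : findim V -> continuous f.
Proof.
move=> [m [e [l [cl le]]]].
have -> : (f : V -> W) = fun x => \sum_i l i x *: f (e i).
  apply/funext => x; rewrite [in LHS](le x) linear_sum.
  by apply: eq_bigr => i _; rewrite linearZ.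
have : Ck 0 setT (fun x => \sum_i l i x *: f (e i)).
  apply: Ck_sum => [|i]; first exact: openT.
  by apply: CkZ; [exact: openT|exact: (@Ck_lin _ _ _ _ _ (l i))|exact: Ck_cst].
by move=> H x; exact: H.
Qed.

End Composition.

(** * Closure properties of smooth maps *)

Section Smooth.
Variable R : realType.
Implicit Types V W Z : normedModType R.

Lemma findim_R : findim R.
Proof.
exists unit, (fun=> 1), (fun=> idfun); split=> [_ x|w]; first exact: cvg_id.
by rewrite big_const/= card_unit /= addr0 [RHS]mulr1.
Qed.

Lemma findim_rV n : findim 'rV[R]_n.
Proof.
have ll i : linear (fun w : 'rV[R]_n => w 0 i : R^o).
  by move=> a u v; rewrite !mxE.
pose L i : {linear 'rV[R]_n -> R^o} :=
  HB.pack (fun w : 'rV[R]_n => w 0 i : R^o) (GRing.isLinear.Build _ _ _ _ _ (ll i)).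
exists 'I_n, (fun i => delta_mx 0 i), L; split=> [i|w].
  exact: coord_continuous.
exact: row_sum_delta.
Qed.

Lemma findim_prod V W : findim V -> findim W -> findim (V * W)%type.
Proof.
move=> [J [e [l [cl le]]]] [K [g [h [ch hg]]]].
have l1 i : linear (fun w : V * W => l i w.1 : R^o) by move=> a u v; rewrite linearP.
have l2 i : linear (fun w : V * W => h i w.2 : R^o) by move=> a u v; rewrite linearP.
pose L (i : J + K) : {linear (V * W)%type -> R^o} := match i with
 | inl i => HB.pack (fun w : V * W => l i w.1 : R^o)
              (GRing.isLinear.Build _ _ _ _ _ (l1 i))
 | inr i => HB.pack (fun w : V * W => h i w.2 : R^o)
              (GRing.isLinear.Build _ _ _ _ _ (l2 i))
 end.
exists (J + K)%type, (fun i => match i with inl i => (e i, 0) | inr i => (0, g i) end), L.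
split=> [[i|i]|w].
- by move=> x; apply: (@continuous_comp _ _ _ fst (l i)); [exact: cvg_fst|exact: cl].
- by move=> x; apply: (@continuous_comp _ _ _ snd (h i)); [exact: cvg_snd|exact: ch].
rewrite big_sumType/=.
have sum_pair (T : finType) (F : T -> V * W) :
    \sum_i F i = (\sum_i (F i).1, \sum_i (F i).2).
  elim: (index_enum T) => [|j r IH]; first by rewrite !big_nil.
  by rewrite !big_cons IH; case: (F j).
rewrite !sum_pair/=.
rewrite (eq_bigr (fun i => h i w.2 *: g i))//.
rewrite [X in (X, _) + _](_ : _ = w.1); last by rewrite [RHS]le.
rewrite [X in _ + (_, X)](_ : _ = w.2); last by rewrite [RHS]hg.
rewrite !big1 ?scaler0// => *; rewrite ?scaler0//.
by case: w => x y; congr (_, _); rewrite /= ?addr0 ?add0r.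
Qed.

Lemma mk_linear V W (f : V -> W) : linear f -> exists F : {linear V -> W}, f = F.
Proof.
move=> lf.
pose F : {linear V -> W} := HB.pack f (GRing.isLinear.Build _ _ _ _ _ lf).
by exists F.
Qed.

Lemma smooth_linear V W (U : set V) (f : V -> W) :
  findim V -> linear f -> smooth_on U f.
Proof.
by move=> fV /mk_linear[F ->] k; apply: Ck_lin; exact: findim_lin_continuous.
Qed.

Lemma derive_linear V W Z (h : W -> Z) (f : V -> W) x v :
  findim W -> linear h -> differentiable f x ->
  'D_v (fun y => h (f y)) x = h ('D_v f x).
Proof.
by move=> fW /mk_linear[F ->] df; apply: derive_lin => //; exact: findim_lin_continuous.
Qed.

Lemma smooth_comp V W Z (U : set V) (O : set W) (f : V -> W) (g : W -> Z) :
  findim W -> open U -> open O -> (forall x, U x -> O (f x)) ->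
  smooth_on U f -> smooth_on O g -> smooth_on U (fun x => g (f x)).
Proof. by move=> fW oU oO UO sf sg k; apply: (@Ck_comp _ _ _ _ k U O). Qed.

Lemma smooth_linl V W Z (U : set V) (h : W -> Z) (f : V -> W) :
  findim W -> linear h -> open U -> smooth_on U f ->
  smooth_on U (fun x => h (f x)).
Proof.
move=> fW lh oU sf.
by apply: (@smooth_comp _ _ _ U setT) => //; [exact: openT|exact: smooth_linear].
Qed.

Lemma smooth_cst V W (U : set V) (w : W) : smooth_on U (fun=> w).
Proof. by move=> k; exact: Ck_cst. Qed.

Lemma smoothD V W (U : set V) (f g : V -> W) : open U ->
  smooth_on U f -> smooth_on U g -> smooth_on U (fun x => f x + g x).
Proof. by move=> oU sf sg k; exact: CkD. Qed.

Lemma smoothZ V W (U : set V) (a : V -> R) (g : V -> W) : open U ->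
  smooth_on U a -> smooth_on U g -> smooth_on U (fun x => a x *: g x).
Proof. by move=> oU sf sg k; exact: CkZ. Qed.

Lemma smoothM V (U : set V) (a g : V -> R) : open U ->
  smooth_on U a -> smooth_on U g -> smooth_on U (fun x => a x * g x).
Proof. exact: smoothZ. Qed.

Lemma smoothN V W (U : set V) (f : V -> W) : open U ->
  smooth_on U f -> smooth_on U (fun x => - f x).
Proof.
move=> oU sf.
have -> : (fun x => - f x) = fun x => (-1 : R) *: f x.
  by apply/funext => x; rewrite scaleN1r.
by apply: smoothZ => //; exact: smooth_cst.
Qed.

Lemma smooth_sum V W (U : set V) (J : Type) (r : seq J) (F : J -> V -> W) :
  open U -> (forall j, smooth_on U (F j)) ->
  smooth_on U (fun x => \sum_(j <- r) F j x).
Proof. by move=> oU sF k; apply: Ck_sum => // j; exact: sF. Qed.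

Lemma smoothS V W (U O : set V) (f : V -> W) :
  U `<=` O -> smooth_on O f -> smooth_on U f.
Proof. by move=> UO sf k; apply: CkS (sf k). Qed.

Lemma smooth_differentiable V W (U : set V) (f : V -> W) x :
  smooth_on U f -> U x -> differentiable f x.
Proof. by move=> /(_ 1%N)[+ _]; exact. Qed.

Lemma smooth_continuous V W (U : set V) (f : V -> W) x :
  smooth_on U f -> U x -> {for x, continuous f}.
Proof. by move=> /(_ 0%N); exact. Qed.

Lemma smooth_derive V W (U : set V) (f : V -> W) v :
  smooth_on U f -> smooth_on U (fun x => 'D_v f x).
Proof. by move=> sf k; have [_] := sf k.+1; exact. Qed.

Lemma smooth_pair V W Z (U : set V) (f : V -> W) (g : V -> Z) :
  findim W -> findim Z -> open U ->
  smooth_on U f -> smooth_on U g -> smooth_on U (fun x => (f x, g x)).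
Proof.
move=> fW fZ oU sf sg.
have -> : (fun x => (f x, g x)) = fun x => (f x, 0) + (0, g x).
  by apply/funext => x; congr (_, _); rewrite /= ?addr0 ?add0r.
apply: smoothD => //.
- apply: (@smooth_linl _ _ _ _ (fun w => (w, 0))) => // a u v.
  by congr (_, _) => /=; rewrite scaler0 addr0.
- apply: (@smooth_linl _ _ _ _ (fun w => (0, w))) => // a u v.
  by congr (_, _) => /=; rewrite scaler0 addr0.
Qed.

Lemma derive_pair V W Z (f : V -> W) (g : V -> Z) x v :
  differentiable f x -> differentiable g x ->
  'D_v (fun y => (f y, g y)) x = ('D_v f x, 'D_v g x).
Proof.
move=> df dg; rewrite deriveE; last exact: differentiable_pair.
by rewrite diff_pair// !deriveE.
Qed.

(** The derivative [- v * (x^-1 * x^-1)] is a polynomial in the reciprocal itself, so C^k regularity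
    of the reciprocal gives C^(k+1). *)
Lemma smooth_inv : smooth_on [set x : R | x != 0] (fun x => x^-1).
Proof.
have oU : open [set x : R | x != 0] by exact: open_neq.
elim=> [|k IH].
  by move=> x /= x0; exact: inv_continuous.
split=> [x /= x0|v]; first exact: differentiable_Rinv.
have CV : Ck k [set x : R | x != 0] (fun x => (- v) * (x^-1 * x^-1)).
  by apply: (@CkZ R R R) => //; [exact: Ck_cst|exact: (@CkZ R R R)].
apply: Ck_eq CV => //.
  move=> x /= x0; rewrite deriveE; last exact: differentiable_Rinv.
  by rewrite diff_Rinv//= /GRing.scale/=; field.
Qed.

Lemma smoothV V (U : set V) (f : V -> R) : open U ->
  (forall x, U x -> f x != 0) -> smooth_on U f -> smooth_on U (fun x => (f x)^-1).
Proof.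
move=> oU f0 sf.
apply: (@smooth_comp _ _ _ U [set x : R | x != 0]) => //; last exact: smooth_inv.
  exact: findim_R.
Qed.

Lemma smooth_local V W (U : set V) (f : V -> W) :
  (forall x, U x -> exists (B : set V),
     [/\ open B, B x & smooth_on B f]) -> smooth_on U f.
Proof.
move=> H k; apply: Ck_local => x /H [B [oB Bx sf]].
by exists B, f.
Qed.

End Smooth.

(** * Inverses of functions of one real variable *)

Section Inverse.
Variable R : realType.

(** Two points with the same value would enclose a critical point, by Rolle's theorem. *)
Lemma derive_neq0_inj (A : set R) (u : R -> R) : is_interval A ->
  (forall s, A s -> differentiable u s) -> (forall s, A s -> 'D_1 u s != 0) ->
  forall a b, A a -> A b -> u a = u b -> a = b.
Proof.
move=> iA du u0.
suff H a b : A a -> A b -> u a = u b -> ~ a < b.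
  move=> a b Aa Ab uab; case: (ltgtP a b) => // ab.
    by case: (H a b).
  by case: (H b a).
move=> Aa Ab uab ltab.
have subA x : x \in `[a, b] -> A x.
  by rewrite in_itv/= => /andP[ax xb]; apply: (iA a b) => //; rewrite ax.
have [||c cab [_ Dc]] := @Rolle R u a b ltab _ _ uab.
- move=> x xab; apply/diff_derivable/du/subA; exact: subset_itv_oo_cc.
- apply: continuous_in_subspaceT => x; rewrite inE => /subA Ax.
  exact/differentiable_continuous/du.
have /u0 : A c by apply: subA; exact: subset_itv_oo_cc.
by rewrite Dc eqxx.
Qed.

Lemma is_interval_ball (x e : R) : is_interval (ball x e).
Proof.
rewrite -ball_normE => a b /= + + z /andP[az zb].
by rewrite !ltr_distlC => /andP[a1 a2] /andP[b1 b2]; apply/andP; split; lra.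
Qed.

(** On a ball around [s0] the map [u] is injective, so choosing a preimage in that ball defines a
    left inverse; the default 0 is never taken at values of [u] on the ball. Continuity of [u] near
    [s0] makes the left inverse a right inverse near [u s0]. *)
Lemma local_inverse (A : set R) (u : R -> R) s0 : open A -> A s0 ->
  (forall s, A s -> differentiable u s) -> (forall s, A s -> 'D_1 u s != 0) ->
  exists tau, [/\ \forall s \near s0, tau (u s) = s,
    \forall y \near u s0, u (tau y) = y & is_derive (u s0) 1 tau ('D_1 u s0)^-1].
Proof.
move=> oA As0 du u0.
have /nbhs_ballP[e /= e0 eA] := open_nbhs_nbhs (conj oA As0).
pose B := ball s0 e.
have injB := @derive_neq0_inj B u (@is_interval_ball _ _)
  (fun s Bs => du s (eA s Bs)) (fun s Bs => u0 s (eA s Bs)).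
pose tau y := xget 0 [set s | B s /\ u s = y].
have nB : \forall s \near s0, B s by exact: nbhsx_ballx.
have tauK : {near s0, cancel u tau}.
  apply: filterS nB => s Bs; rewrite /tau.
  by case: xgetP => [t _ [Bt]|/(_ s)[]//]; exact: injB.
have cu : {near s0, continuous u}.
  by apply: filterS nB => s /eA As; exact/differentiable_continuous/du.
exists tau; split=> //; first exact: near_continuous_can_sym.
apply: is_derive_inverse => //; last exact: u0.
by apply: DeriveDef => //; exact/diff_derivable/du.
Qed.

(** Only the identity [G (u s) = g s] is known of [G], not even continuity: this is how a function
    defined by choice becomes smooth. The derivative of [G] at [u s] is [(v / u') *: g'] at [s],
    which is an identity of the same shape with a new smooth [g], so the induction on the order of
    differentiability closes. *)
Lemma smooth_reparam (W : normedModType R) (A : set R) (u : R -> R)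
    (g G : R -> W) : open A -> smooth_on A u -> (forall s, A s -> 'D_1 u s != 0) ->
  smooth_on A g -> (forall s, A s -> G (u s) = g s) ->
  open (u @` A) /\ smooth_on (u @` A) G.
Proof.
move=> oA su u0.
have du s : A s -> differentiable u s by exact: smooth_differentiable.
have oB : open (u @` A).
  rewrite openE => _ [s0 As0 <-]; rewrite /interior.
  have [tau [tauK uK [dtau _]]] := local_inverse oA As0 du u0.
  have ctau : {for u s0, continuous tau}.
    by apply/differentiable_continuous/derivable1_diffP.
  have tau0 := nbhs_singleton tauK.
  have : \forall y \near u s0, A (tau y).
    apply: ctau; rewrite tau0; exact: open_nbhs_nbhs.
  by apply: filterS2 uK => y uty At; exists (tau y).
move=> sg Gg; split=> //.
have H (g1 G1 : R -> W) s0 v : smooth_on A g1 -> (forall s, A s -> G1 (u s) = g1 s) ->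
    A s0 -> differentiable G1 (u s0) /\
      'D_v G1 (u s0) = (v * ('D_1 u s0)^-1) *: 'D_1 g1 s0.
  move=> sg1 G1g As0.
  have [tau [tauK uK [dtau tau']]] := local_inverse oA As0 du u0.
  have /derivable1_diffP dtau1 := dtau.
  have ctau : {for u s0, continuous tau} by exact: differentiable_continuous.
  have tau0 := nbhs_singleton tauK.
  have nG : \forall y \near u s0, g1 (tau y) = G1 y.
    have : \forall y \near u s0, A (tau y).
      apply: ctau; rewrite tau0; exact: open_nbhs_nbhs.
    by apply: filterS2 uK => y uty /G1g; rewrite uty.
  have dg1 : differentiable g1 (tau (u s0)).
    by rewrite tau0; exact: smooth_differentiable As0.
  split.
    apply: near_eq_differentiable nG _.
    exact: (@differentiable_comp _ _ _ _ tau g1).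
  rewrite -(near_eq_derive v nG) deriveE; last first.
    exact: (@differentiable_comp _ _ _ _ tau g1).
  rewrite (@diff_comp _ _ _ _ tau g1)//= (deriv1E dtau) derive1E tau' tau0.
  have lin c : 'd g1 s0 c = c *: 'd g1 s0 1.
    by rewrite -linearZ; congr ('d g1 s0 _); rewrite [RHS]mulr1.
  by rewrite lin (@deriveE _ _ _ g1 s0)// -tau0.
move=> k; elim: k g G sg Gg => [|k IH] g1 G1 sg1 Gg1.
  move=> _ [s As <-]; apply: differentiable_continuous.
  exact: (H _ _ _ 0 sg1 Gg1 As).1.
split=> [_ [s As <-]|v]; first exact: (H _ _ _ 0 sg1 Gg1 As).1.
apply: (IH (fun s => (v * ('D_1 u s)^-1) *: 'D_1 g1 s)); last first.
  by move=> s As; exact: (H _ _ _ _ sg1 Gg1 As).2.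
apply: smoothZ => //; last exact: smooth_derive.
apply: smoothM => //; first exact: smooth_cst.
by apply: smoothV => //; exact: smooth_derive.
Qed.

(** The square root is the identity reparametrised by squaring, whose derivative [s + s] does not
    vanish for positive [s]. *)
Lemma smooth_sqrt : smooth_on [set x : R | 0 < x] (@Num.sqrt R).
Proof.
pose A := [set x : R | 0 < x].
have D1 (s : R) : 'D_1 (fun x : R => x * x) s = s + s.
  rewrite (@deriveM R R id id)//.
  by rewrite derive_id /GRing.scale/= !mulr1.
have [||s As|//|s As|_] := @smooth_reparam R A (fun s => s * s) id (@Num.sqrt R).
- exact: open_gt.
- by apply: smoothM; try exact: open_gt; apply: smooth_linear => //; exact: findim_R.
- by rewrite D1 gt_eqF// addr_gt0.
- by apply: smooth_linear => //; exact: findim_R.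
- by rewrite -expr2 sqrtr_sqr ger0_norm// ltW.
apply: smoothS => x /= x0; exists (Num.sqrt x); first by rewrite /A/= sqrtr_gt0.
by rewrite -expr2 sqr_sqrtr// ltW.
Qed.

End Inverse.

(** * Spheres and their tangent vectors *)

Section Dot.
Variables (R : realType) (n : nat).
Implicit Types (u v w : 'rV[R]_n) (a : R).

Lemma dotC u v : dot u v = dot v u.
Proof. by apply: eq_bigr => i _; rewrite mulrC. Qed.

Lemma dotDl u v w : dot (u + v) w = dot u w + dot v w.
Proof. by rewrite /dot -big_split/=; apply: eq_bigr => i _; rewrite mxE mulrDl. Qed.

Lemma dotZl a u v : dot (a *: u) v = a * dot u v.
Proof. by rewrite /dot big_distrr/=; apply: eq_bigr => i _; rewrite mxE mulrA. Qed.

Lemma dotDr u v w : dot u (v + w) = dot u v + dot u w.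
Proof. by rewrite dotC dotDl !(dotC u). Qed.

Lemma dotZr a u v : dot u (a *: v) = a * dot u v.
Proof. by rewrite dotC dotZl dotC. Qed.

Lemma dotNl u v : dot (- u) v = - dot u v.
Proof. by rewrite -scaleN1r dotZl mulN1r. Qed.

Lemma dotNr u v : dot u (- v) = - dot u v.
Proof. by rewrite dotC dotNl dotC. Qed.

Definition dotE := (dotDl, dotDr, dotZl, dotZr, dotNl, dotNr).

Lemma dot0l u : dot 0 u = 0.
Proof. by rewrite -(scale0r 0) dotZl mul0r. Qed.

Lemma dot0r u : dot u 0 = 0.
Proof. by rewrite dotC dot0l. Qed.

Lemma dot_ge0 u : 0 <= dot u u.
Proof. by apply: sumr_ge0 => i _; rewrite -expr2 sqr_ge0. Qed.

Lemma dot_eq0 u : dot u u = 0 -> u = 0.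
Proof.
move=> /psumr_eq0P H; apply/rowP => i; rewrite mxE.
have /eqP := H (fun i _ => sqr_ge0 (u 0 i)) i isT.
by rewrite mulf_eq0 orbb => /eqP.
Qed.

Lemma coord_linear i : linear (fun w : 'rV[R]_n => w 0 i : R^o).
Proof. by move=> a u v; rewrite !mxE. Qed.

Lemma smooth_dot (V : normedModType R) (U : set V) (f g : V -> 'rV[R]_n) : open U ->
  smooth_on U f -> smooth_on U g -> smooth_on U (fun x => dot (f x) (g x)).
Proof.
move=> oU sf sg; apply: smooth_sum => // i; apply: smoothM => //.
  apply: (@smooth_linl _ _ _ R^o _ (fun w : 'rV[R]_n => w 0 i)) => //.
    exact: findim_rV.
  exact: coord_linear.
apply: (@smooth_linl _ _ _ R^o _ (fun w : 'rV[R]_n => w 0 i)) => //.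
  exact: findim_rV.
exact: coord_linear.
Qed.

Lemma derive_dot (V : normedModType R) (f g : V -> 'rV[R]_n) (x v : V) :
  differentiable f x -> differentiable g x ->
  'D_v (fun y => dot (f y) (g y)) x =
    dot ('D_v f x) (g x) + dot (f x) ('D_v g x).
Proof.
move=> df dg.
have dc (h : V -> 'rV[R]_n) i : differentiable h x ->
    differentiable (fun y => h y 0 i) x /\
    'D_v (fun y => h y 0 i) x = 'D_v h x 0 i.
  move=> dh; split.
    apply: (@differentiable_comp _ _ _ _ h (fun w : 'rV[R]_n => w 0 i)) => //.
    exact: differentiable_coord.
  apply: (@derive_linear _ _ _ _ (fun w : 'rV[R]_n => w 0 i : R^o)) => //.
    exact: findim_rV.
  exact: coord_linear.
have -> : (fun y => dot (f y) (g y)) =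
    \sum_(i < n) (fun y => f y 0 i * g y 0 i).
  by apply/funext => y; rewrite fct_sumE.
have dfi i : derivable (fun y => f y 0 i) x v.
  exact/diff_derivable/(dc f i df).1.
have dgi i : derivable (fun y => g y 0 i) x v.
  exact/diff_derivable/(dc g i dg).1.
rewrite derive_sum => [|i]; last exact: derivableM.
rewrite -big_split/=; apply: eq_bigr => i _.
rewrite deriveM// (dc f i df).2 (dc g i dg).2 /GRing.scale/=.
by rewrite addrC [g x 0 i * _]mulrC.
Qed.

Lemma derive_sphere (c : R -> 'rV[R]_n) s :
  differentiable c s -> (\forall u \near s, sphere R n (c u)) ->
  dot (c s) ('D_1 c s) = 0.
Proof.
move=> dc sc.
have E : \near s, dot (c s) (c s) = cst (1 : R) s by apply: filterS sc => u.
have : 'D_1 (fun t => dot (c t) (c t)) s = 0.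
  by rewrite (near_eq_derive _ E) derive_cst.
rewrite derive_dot// dotC => /eqP; rewrite -mulr2n mulrn_eq0/= => /eqP.
by [].
Qed.

(** The curve is the image of the line [s v / 2] under inverse stereographic projection from [- x],
    that is [((1 - a s^2) x + s v) / (1 + a s^2)] with [a = |v|^2 / 4]. It is rational, defined for
    all [s], and covers [v = 0]. Writing it as [x + s *: h s] makes its velocity at 0 equal to
    [h 0 = v]. *)
Lemma sphere_curve x v : sphere R n x -> dot x v = 0 ->
  exists c : R -> 'rV[R]_n, [/\ smooth_on setT c, forall s, sphere R n (c s),
    c 0 = x & 'D_1 c 0 = v].
Proof.
move=> sx xv; pose a := dot v v / 4.
have a0 : 0 <= a by rewrite divr_ge0 ?dot_ge0.
have w0 (s : R) : 1 + a * (s * s) != 0.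
  by rewrite gt_eqF// ltr_pwDl// mulr_ge0// -expr2 sqr_ge0.
pose h (s : R) := (1 + a * (s * s))^-1 *: (v + (- (2 * a) * s) *: x).
have sid : smooth_on setT (fun s : R => s).
  by apply: smooth_linear => //; exact: findim_R.
have oT : open [set: R] by exact: openT.
have sh : smooth_on setT h.
  apply: smoothZ => //.
    apply: smoothV => //; apply: smoothD => //; first exact: smooth_cst.
    by apply: smoothM => //; [exact: smooth_cst|exact: smoothM].
  apply: smoothD => //; first exact: smooth_cst.
  apply: smoothZ => //; last exact: smooth_cst.
  by apply: smoothM => //; exact: smooth_cst.
have ssh : smooth_on setT (fun s : R => s *: h s) by exact: smoothZ.
exists (fun s : R => x + s *: h s); split.
- by apply: smoothD => //; exact: smooth_cst.
- move=> s; have := sx; rewrite /sphere/= !dotE => -> ; rewrite xv (dotC v x) xv.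
  have vv : dot v v = 4 * a by rewrite /a; field.
  by rewrite vv; field.
- by rewrite scale0r addr0.
have dh : differentiable h 0 by exact: smooth_differentiable sh _.
have did : differentiable (fun s : R => s) 0 by exact: smooth_differentiable sid _.
have [dsh Dsh] := differentiable_scale did dh.
rewrite deriveD; [|exact: derivable_cst|exact: diff_derivable].
rewrite derive_cst Dsh derive_id scale1r scale0r addr0 add0r /h.
by rewrite !mulr0 addr0 invr1 scale1r scale0r addr0.
Qed.

Lemma tangent_sphere x v : sphere R n x ->
  tangent (sphere R n) x v <-> dot x v = 0.
Proof.
move=> sx; split=> [[e [c [e0 sc cS <- <-]]]|/(sphere_curve sx)[c [sc cS c0 Dc]]].
  rewrite derive1E; apply: derive_sphere.
    by apply: smooth_differentiable sc _; exact: ballxx.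
  by exists e => // u; exact: cS.
exists 1, c; split=> //; first by apply: smoothS sc.
by rewrite derive1E.
Qed.

End Dot.

(** * Embedded submanifolds *)

Section Manifold.
Variable R : realType.
Implicit Types V W : normedModType R.

Lemma smooth_preimage_open V W (U : set V) (O : set W) (f : V -> W) :
  open U -> open O -> smooth_on U f -> open (U `&` f @^-1` O).
Proof.
move=> oU oO sf; rewrite openE => x [Ux Ofx]; apply: filterI.
  exact: open_nbhs_nbhs.
by apply: (smooth_continuous sf Ux); exact: open_nbhs_nbhs.
Qed.

Lemma open_setX (S T : topologicalType) (A : set S) (B : set T) :
  open A -> open B -> open (A `*` B).
Proof.
move=> oA oB; rewrite openE => -[x y] [/= Ax By].
by exists (A, B) => //; split; exact: open_nbhs_nbhs.
Qed.

Lemma open_manifold k (D : set 'rV[R]_k) : open D -> smooth_manifold k D.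
Proof.
move=> oD p Dp; exists D, D, id, id; split=> //; split=> // x; last by case.
- by apply: smooth_linear; first exact: findim_rV.
- by apply: smooth_linear; first exact: findim_rV.
Qed.

Lemma manifold_local V k (S : set V) :
  (forall p, S p -> exists B : set V,
     [/\ open B, B p & smooth_manifold k (S `&` B)]) -> smooth_manifold k S.
Proof.
move=> H p Sp; have [B [oB Bp /(_ p (conj Sp Bp))]] := H p Sp.
move=> [U [D [phi [psi [[oU Up oD] [sphi spsi D1 D2]]]]]].
exists (U `&` B), D, phi, psi; split; first by split=> //; exact: openI.
split=> //; first by apply: smoothS spsi => q [].
  by move=> x /D1[[[Sx Bx] Ux] e].
by move=> q [Sq [Uq Bq]]; exact: D2.
Qed.

(** A diffeomorphism of subsets, with both directions extended to open sets. It transports charts as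
    well as the topology, so a single such map serves both claims about a lift. *)
Definition smooth_iso V W (S : set V) (S' : set W) :=
  exists (OV : set V) (OW : set W) (g : V -> W) (h : W -> V),
    [/\ open OV, open OW, S `<=` OV & S' `<=` OW] /\
    [/\ smooth_on OV g, smooth_on OW h,
        forall x, S x -> S' (g x) /\ h (g x) = x &
        forall y, S' y -> S (h y) /\ g (h y) = y].

Lemma manifold_iso V W k (S : set V) (S' : set W) :
  findim V -> findim W ->
  smooth_iso S S' -> smooth_manifold k S' -> smooth_manifold k S.
Proof.
move=> fV fW [OV [OW [g [h [[oOV oOW SO SO'] [sg sh gK hK]]]]]] H p Sp.
have [/H + gp] := gK p Sp.
move=> [U [D [phi [psi [[oU Up oD] [sphi spsi D1 D2]]]]]].
exists (OV `&` g @^-1` U), D, (fun x => h (phi x)), (fun v => psi (g v)).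
have oU' : open (OV `&` g @^-1` U) by exact: smooth_preimage_open.
split; first by split=> //; split=> //; exact: SO.
split.
- apply: (@smooth_comp _ _ _ _ D OW) => //.
  by move=> x /D1[[/SO']].
- apply: (@smooth_comp _ _ _ _ _ U) => //; first by move=> x [].
  by apply: smoothS sg => x [].
- move=> x Dx; have [[S'x Ux] psix] := D1 x Dx.
  have [Shx ghx] := hK _ S'x.
  by rewrite /= ghx; split=> //; split=> //; split=> //; exact: SO.
- move=> q [Sq [Oq Uq]]; have [S'g hg] := gK q Sq.
  by have [Dq pq] := D2 (g q) (conj S'g Uq); rewrite pq.
Qed.

Lemma homeomorphic_iso V W (S : set V) (S' : set W) :
  smooth_iso S S' -> homeomorphic S S'.
Proof.
move=> [OV [OW [g [h [[oOV oOW SO SO'] [sg sh gK hK]]]]]].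
exists g, h; split=> //; apply: continuous_in_subspaceT => x /set_mem.
  by move=> /SO; exact: smooth_continuous.
by move=> /SO'; exact: smooth_continuous.
Qed.

Lemma lsubmx_linear k l : linear (@lsubmx R 1 k l).
Proof. by move=> a u v; rewrite linearP. Qed.

Lemma rsubmx_linear k l : linear (@rsubmx R 1 k l).
Proof. by move=> a u v; rewrite linearP. Qed.

Lemma row_mx_linear k l :
  linear (fun z : 'rV[R]_k * 'rV[R]_l => row_mx z.1 z.2).
Proof. by move=> a u v; rewrite /= -add_row_mx scale_row_mx. Qed.

Lemma smooth_fst V W (U : set (V * W)) : findim V -> findim W ->
  smooth_on U (fst : V * W -> V).
Proof. by move=> fV fW; apply: smooth_linear => //; exact: findim_prod. Qed.

Lemma smooth_snd V W (U : set (V * W)) : findim V -> findim W ->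
  smooth_on U (snd : V * W -> W).
Proof. by move=> fV fW; apply: smooth_linear => //; exact: findim_prod. Qed.

Lemma smooth_prod V W V' W' (U : set V) (O : set W) (f : V -> V') (g : W -> W') :
  findim V -> findim W -> findim V' -> findim W' -> open U -> open O ->
  smooth_on U f -> smooth_on O g ->
  smooth_on (U `*` O) (fun z => (f z.1, g z.2)).
Proof.
move=> fV fW fV' fW' oU oO sf sg.
have oUO : open (U `*` O) by exact: open_setX.
apply: smooth_pair => //.
  apply: (@smooth_comp _ _ _ _ _ U) => //; first by move=> z [].
  exact: smooth_fst.
apply: (@smooth_comp _ _ _ _ _ O) => //; first by move=> z [].
exact: smooth_snd.
Qed.

Lemma manifold_prod V W k l (S : set V) (S' : set W) : findim V -> findim W ->
  smooth_manifold k S -> smooth_manifold l S' ->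
  smooth_manifold (k + l) (S `*` S').
Proof.
move=> fV fW mS mS' [p p'] [/= Sp S'p].
have [U [D [phi [psi [[oU Up oD] [sphi spsi D1 D2]]]]]] := mS p Sp.
have [U' [D' [phi' [psi' [[oU' Up' oD'] [sphi' spsi' D1' D2']]]]]] := mS' p' S'p.
pose split_row (x : 'rV[R]_(k + l)) := (lsubmx x, rsubmx x).
have fk := findim_rV R.
have ssplit : smooth_on setT split_row.
  apply: smooth_pair; [exact: fk|exact: fk|exact: openT| |].
    by apply: smooth_linear; [exact: fk|exact: lsubmx_linear].
  by apply: smooth_linear; [exact: fk|exact: rsubmx_linear].
have oDD : open (D `*` D') by exact: open_setX.
have oUU : open (U `*` U') by exact: open_setX.
have oE : open (setT `&` split_row @^-1` (D `*` D')).
  by apply: smooth_preimage_open => //; exact: openT.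
exists (U `*` U'), (setT `&` split_row @^-1` (D `*` D')),
  (fun x => (phi (split_row x).1, phi' (split_row x).2)),
  (fun z => row_mx (psi z.1) (psi' z.2)).
split=> //; split.
- apply: (@smooth_comp _ _ _ _ _ (D `*` D') split_row
      (fun z => (phi z.1, phi' z.2))) => //.
  + by apply: findim_prod; exact: fk.
  + by move=> x [].
  + exact: smoothS ssplit.
  + by apply: smooth_prod => //; exact: fk.
- apply: (@smooth_linl _ _ _ _ _ (fun z : 'rV[R]_k * 'rV[R]_l => row_mx z.1 z.2)
      (fun z => (psi z.1, psi' z.2))) => //.
  + by apply: findim_prod; exact: fk.
  + exact: row_mx_linear.
  + by apply: smooth_prod => //; exact: fk.
- move=> x [_ [/= /D1[[S1 U1] e1] /D1'[[S2 U2] e2]]].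
  by split=> //; rewrite e1 e2 hsubmxK.
- move=> [q q'] [[/= Sq S'q] [/= Uq U'q]].
  have [Dq e1] := D2 q (conj Sq Uq); have [D'q e2] := D2' q' (conj S'q U'q).
  by rewrite /split_row/= row_mxKl row_mxKr e1 e2.
Qed.

Lemma open_manifold_R (D : set R) : open D -> smooth_manifold 1 D.
Proof.
move=> oD.
pose c (r : R) : 'rV[R]_1 := const_mx r.
have lc : linear c by move=> a u v; apply/rowP => i; rewrite !mxE.
pose e (x : 'rV[R]_1) : R := x 0 0.
have le : linear (e : 'rV[R]_1 -> R^o) by move=> a u v; rewrite /e !mxE.
have fR := findim_R R; have f1 := findim_rV R 1.
have sc U : smooth_on U c by exact: smooth_linear.
have se U : smooth_on U e by exact: (@smooth_linear _ _ R^o).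
apply: (@manifold_iso _ _ _ _ (setT `&` e @^-1` D)) => //; last first.
  by apply: open_manifold; apply: smooth_preimage_open => //; exact: openT.
exists setT, setT, c, e; split; first by split=> //; exact: openT.
split=> // x.
  by move=> Dx; rewrite /= /e mxE.
by move=> [_ Dx]; split=> //; apply/rowP => i; rewrite mxE /e ord1.
Qed.

End Manifold.

(** * Stereographic charts *)

Section SphereManifold.
Variables (R : realType) (n : nat).

Definition row_cons (a : R) (y : 'rV[R]_n) : 'rV[R]_n.+1 :=
  \row_j oapp (y 0) a (unlift ord0 j).

Definition row_tail (x : 'rV[R]_n.+1) : 'rV[R]_n := \row_j x 0 (lift ord0 j).

Lemma row_cons0 a y : row_cons a y 0 0 = a.
Proof. by rewrite mxE unlift_none. Qed.

Lemma row_consK a y : row_tail (row_cons a y) = y.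
Proof. by apply/rowP => j; rewrite !mxE liftK. Qed.

Lemma row_eta (x : 'rV[R]_n.+1) : row_cons (x 0 0) (row_tail x) = x.
Proof.
by apply/rowP => j; rewrite mxE; case: unliftP => [i|] ->; rewrite /= ?mxE; congr (x _ _).
Qed.

Lemma dot_row (x z : 'rV[R]_n.+1) :
  dot x z = x 0 0 * z 0 0 + dot (row_tail x) (row_tail z).
Proof.
rewrite /dot big_ord_recl; congr (_ + _).
by apply: eq_bigr => i _; rewrite !mxE.
Qed.

Lemma row_tail_linear : linear row_tail.
Proof. by move=> a u v; apply/rowP => j; rewrite !mxE. Qed.

Lemma row_cons_linear : linear (fun z : R * 'rV[R]_n => row_cons z.1 z.2).
Proof.
by move=> a u v; apply/rowP => j; rewrite !mxE; case: unlift => [i|] /=; rewrite ?mxE.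
Qed.

Variable e : R.
Hypothesis e2 : e * e = 1.

(** As [e] is 1 or -1, on the sphere this leaves out a single point, the pole with first coordinate
    [- e], from which [stereo] projects. *)
Definition cap : set 'rV[R]_n.+1 := [set x | 0 < 1 + e * x 0 0].

Definition stereo (x : 'rV[R]_n.+1) := (1 + e * x 0 0)^-1 *: row_tail x.
Definition unstereo (y : 'rV[R]_n) :=
  row_cons (e * ((1 - dot y y) * (1 + dot y y)^-1))
           ((2 * (1 + dot y y)^-1) *: y).

Lemma smooth_head (V : normedModType R) (U : set V) (f : V -> 'rV[R]_n.+1) :
  open U -> smooth_on U f -> smooth_on U (fun x => f x 0 0 : R).
Proof.
move=> oU sf.
apply: (@smooth_linl _ _ _ R^o _ (fun x : 'rV[R]_n.+1 => x 0 0)) => //.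
  exact: findim_rV.
exact: coord_linear.
Qed.

Lemma smooth_tail (V : normedModType R) (U : set V) (f : V -> 'rV[R]_n.+1) :
  open U -> smooth_on U f -> smooth_on U (fun x => row_tail (f x)).
Proof.
move=> oU sf; apply: smooth_linl => //; first exact: findim_rV.
exact: row_tail_linear.
Qed.

Lemma smooth_cons (V : normedModType R) (U : set V) (a : V -> R) (f : V -> 'rV[R]_n) :
  open U -> smooth_on U a -> smooth_on U f ->
  smooth_on U (fun x => row_cons (a x) (f x)).
Proof.
move=> oU sa sf.
apply: (@smooth_linl _ _ _ _ _ (fun z : R * 'rV[R]_n => row_cons z.1 z.2)
  (fun x => (a x, f x))) => //.
- by apply: findim_prod; [exact: findim_R|exact: findim_rV].
- exact: row_cons_linear.
- by apply: smooth_pair => //; [exact: findim_R|exact: findim_rV].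
Qed.

Lemma smooth_id_rV m (U : set 'rV[R]_m) : smooth_on U id.
Proof. by apply: smooth_linear => //; exact: findim_rV. Qed.

Lemma open_cap : open cap.
Proof.
have -> : cap = setT `&` (fun x : 'rV[R]_n.+1 => 1 + e * x 0 0) @^-1` [set r : R | 0 < r].
  by rewrite setTI.
apply: smooth_preimage_open; [exact: openT|exact: open_gt|].
apply: smoothD; [exact: openT|exact: smooth_cst|].
apply: smoothM; [exact: openT|exact: smooth_cst|].
by apply: smooth_head; [exact: openT|exact: smooth_id_rV].
Qed.

Lemma smooth_stereo (V : normedModType R) (U : set V) f :
  open U -> smooth_on U f -> (forall x, U x -> cap (f x)) ->
  smooth_on U (fun x => stereo (f x)).
Proof.
move=> oU sf Uf; apply: smoothZ => //; last exact: smooth_tail.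
apply: smoothV => // [x /Uf Ux|]; first by rewrite gt_eqF.
apply: smoothD => //; first exact: smooth_cst.
by apply: smoothM => //; [exact: smooth_cst|exact: smooth_head].
Qed.

Lemma dot1_gt0 (y : 'rV[R]_n) : 0 < 1 + dot y y.
Proof. by rewrite ltr_pwDl// dot_ge0. Qed.

Lemma smooth_inv1dot (V : normedModType R) (U : set V) (f : V -> 'rV[R]_n) :
  open U -> smooth_on U f -> smooth_on U (fun x => (1 + dot (f x) (f x))^-1).
Proof.
move=> oU sf; apply: smoothV => // [x _|]; first by rewrite gt_eqF// dot1_gt0.
by apply: smoothD => //; [exact: smooth_cst|exact: smooth_dot].
Qed.

Lemma smooth_unstereo (V : normedModType R) (U : set V) f :
  open U -> smooth_on U f -> smooth_on U (fun x => unstereo (f x)).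
Proof.
move=> oU sf; have si := smooth_inv1dot oU sf; apply: smooth_cons => //.
  apply: smoothM => //; first exact: smooth_cst.
  apply: smoothM => //; apply: smoothD => //; first exact: smooth_cst.
  by apply: smoothN => //; exact: smooth_dot.
by apply: smoothZ => //; apply: smoothM => //; exact: smooth_cst.
Qed.

Lemma unstereo_cap y : 1 + e * unstereo y 0 0 = 2 * (1 + dot y y)^-1.
Proof.
rewrite row_cons0 mulrA e2 mul1r.
by field; rewrite gt_eqF// dot1_gt0.
Qed.

Lemma unstereo_sphere y : sphere R n.+1 (unstereo y).
Proof.
rewrite /sphere/= dot_row row_consK row_cons0 dotZl dotZr mulrACA e2.
by field; rewrite gt_eqF// dot1_gt0.
Qed.

Lemma stereo_dot (x : 'rV[R]_n.+1) : sphere R n.+1 x -> cap x ->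
  dot (stereo x) (stereo x) = (1 - e * x 0 0) * (1 + e * x 0 0)^-1.
Proof.
rewrite /sphere /cap/= dot_row => sx cx; rewrite !dotE.
have -> : dot (row_tail x) (row_tail x) = (1 - e * x 0 0) * (1 + e * x 0 0).
  by rewrite -subr_sqr expr1n exprMn !expr2 e2 mul1r -sx addrC addKr.
by field; rewrite gt_eqF.
Qed.

Lemma unstereoK : cancel unstereo stereo.
Proof.
move=> y; rewrite /stereo unstereo_cap row_consK scalerA mulVf ?scale1r//.
by rewrite mulf_neq0// invr_neq0// gt_eqF// dot1_gt0.
Qed.

Lemma stereoK (x : 'rV[R]_n.+1) : sphere R n.+1 x -> cap x -> unstereo (stereo x) = x.
Proof.
move=> sx cx; rewrite /unstereo stereo_dot// -[RHS]row_eta.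
have c0 : 1 + e * x 0 0 != 0 by rewrite gt_eqF.
have -> : 1 + (1 - e * x 0 0) * (1 + e * x 0 0)^-1 = 2 * (1 + e * x 0 0)^-1.
  by field.
rewrite invfM invrK /stereo scalerA; congr row_cons.
  have -> : x 0 0 = e * (e * x 0 0) by rewrite mulrA e2 mul1r.
  move: (e * x 0 0) c0 => c c0; rewrite (mulrA e e) e2 mul1r.
  by congr (_ * _); field.
rewrite -[RHS]scale1r; congr (_ *: _); by field.
Qed.

Lemma cap_manifold : smooth_manifold n (sphere R n.+1 `&` cap).
Proof.
apply: (@manifold_iso _ _ _ _ _ [set: 'rV[R]_n]); try exact: findim_rV.
  exists cap, setT, stereo, unstereo; split.
    by split=> //; [exact: open_cap|exact: openT].
  split.
  - exact: (smooth_stereo open_cap (@smooth_id_rV _ cap) (fun _ => id)).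
  - exact: (smooth_unstereo openT (@smooth_id_rV _ setT)).
  - by move=> x [sx cx]; split=> //; exact: stereoK.
  - move=> y _; split; last exact: unstereoK.
    split; first exact: unstereo_sphere.
    by rewrite /cap/= unstereo_cap mulr_gt0// invr_gt0 dot1_gt0.
by apply: open_manifold; exact: openT.
Qed.

(* The reflection exchanging [x] and the pole left out by [cap] maps the unit
   vectors orthogonal to [x] to those orthogonal to the pole. On vectors
   orthogonal to [x] it is affine in the stereographic coordinate of [x]. *)
Definition tstereo (z : 'rV[R]_n.+1 * 'rV[R]_n.+1) :=
  (stereo z.1, row_tail z.2 - (e * z.2 0 0) *: stereo z.1).

Definition tunstereo (z : 'rV[R]_n * 'rV[R]_n) :=
  let b := 2 * (1 + dot z.1 z.1)^-1 * dot z.2 z.1 in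
  (unstereo z.1, row_cons (- (e * b)) (z.2 - b *: z.1)).

Lemma unit_tangent_sphereE m (z : 'rV[R]_m * 'rV[R]_m) :
  unit_tangent_sphere R m z <->
  [/\ dot z.1 z.1 = 1, dot z.1 z.2 = 0 & dot z.2 z.2 = 1].
Proof.
split=> [[sz /(tangent_sphere _ sz)]|[sz + ?]] //.
by move=> /(tangent_sphere _ sz).
Qed.

(** Over the cap, [tstereo] maps the fibres isometrically onto one fixed space, so unit vectors go
    to unit vectors and the bundle becomes a product with the sphere of one dimension less. The
    differential of [stereo] itself would be conformal only. *)
Lemma unit_tangent_cap_manifold k : smooth_manifold k (sphere R n) ->
  smooth_manifold (n + k) (unit_tangent_sphere R n.+1 `&` [set z | cap z.1]).
Proof.
move=> mS.
have f1 := findim_rV R n; have f2 := findim_rV R n.+1.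
have ff1 := findim_prod f1 f1; have ff2 := findim_prod f2 f2.
apply: (@manifold_iso _ _ _ _ _ ([set: 'rV[R]_n] `*` sphere R n)) => //; last first.
  by apply: manifold_prod => //; apply: open_manifold; exact: openT.
have oC : open [set z : 'rV[R]_n.+1 * 'rV[R]_n.+1 | cap z.1].
  have -> : [set z : 'rV[R]_n.+1 * 'rV[R]_n.+1 | cap z.1] = cap `*` setT.
    by apply/seteqP; split=> z; [split|case].
  by apply: open_setX; [exact: open_cap|exact: openT].
have oT : open [set: 'rV[R]_n * 'rV[R]_n] by exact: openT.
exists [set z | cap z.1], setT, tstereo, tunstereo; split.
  by split=> // z [].
split.
- have s1 : smooth_on [set z : 'rV[R]_n.+1 * 'rV[R]_n.+1 | cap z.1] fst.
    exact: smooth_fst.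
  have s2 : smooth_on [set z : 'rV[R]_n.+1 * 'rV[R]_n.+1 | cap z.1] snd.
    exact: smooth_snd.
  have ss := smooth_stereo oC s1 (fun _ => id).
  apply: smooth_pair => //; apply: smoothD => //; first exact: smooth_tail.
  apply: smoothN => //; apply: smoothZ => //; apply: smoothM => //.
    exact: smooth_cst.
  exact: smooth_head.
- have s1 : smooth_on [set: 'rV[R]_n * 'rV[R]_n] fst by exact: smooth_fst.
  have s2 : smooth_on [set: 'rV[R]_n * 'rV[R]_n] snd by exact: smooth_snd.
  have sb : smooth_on [set: 'rV[R]_n * 'rV[R]_n]
      (fun z => 2 * (1 + dot z.1 z.1)^-1 * dot z.2 z.1).
    apply: smoothM => //; last exact: smooth_dot.
    by apply: smoothM => //; [exact: smooth_cst|exact: smooth_inv1dot].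
  apply: smooth_pair => //; first exact: smooth_unstereo.
  apply: smooth_cons => //.
    by apply: smoothN => //; apply: smoothM => //; exact: smooth_cst.
  apply: smoothD => //; apply: smoothN => //; exact: smoothZ.
- move=> [x v] [/unit_tangent_sphereE[/= xx xv vv] cx].
  have c0 : 1 + e * x 0 0 != 0 by rewrite gt_eqF.
  have yy := stereo_dot xx cx.
  have xE : row_tail x = (1 + e * x 0 0) *: stereo x.
    by rewrite /stereo scalerA mulfV// scale1r.
  rewrite /tstereo /tunstereo /= stereoK//.
  move: (stereo x) yy xE => y yy xE; set z := row_tail v - _.
  have ty : dot (row_tail v) y = - x 0 0 * v 0 0 * (1 + e * x 0 0)^-1.
    have := xv; rewrite dot_row xE dotZl dotC => /eqP.
    rewrite addrC addr_eq0 => /eqP H; rewrite mulNr -H.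
    by rewrite mulrC mulKf.
  have tt : dot (row_tail v) (row_tail v) = 1 - v 0 0 * v 0 0.
    by rewrite -vv dot_row addrC addKr.
  have e2x : e * (e * x 0 0) = x 0 0 by rewrite mulrA e2 mul1r.
  (* The polar coordinate of [v] is dropped by [tstereo]; the orthogonality of [x] and [v], used in
     [ty], is what allows [b] to recover it. *)
  have bE : 2 * (1 + dot y y)^-1 * dot z y = - (e * v 0 0).
    rewrite /z !dotE ty yy -[X in - X * _]e2x.
    move: (e * x 0 0) c0 => c c0.
    by field; rewrite c0 addrA (addrAC 1) addrK -mulr2n pnatr_eq0.
  rewrite bE; split; last first.
    congr (_, _); rewrite mulrN opprK mulrA e2 mul1r /z scaleNr opprK subrK.
    exact: row_eta.
  split=> //; rewrite /sphere/= /z !dotE (dotC y) ty tt yy.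
  rewrite -[X in - X * _]e2x.
  have e2v : e * v 0 0 * (e * v 0 0) = v 0 0 * v 0 0 by rewrite mulrACA e2 mul1r.
  move: (e * x 0 0) c0 e2v => c c0 e2v.
  have e2v' : e * e * (v 0 0 * v 0 0) = v 0 0 * v 0 0 by rewrite e2 mul1r.
  move: (v 0 0) e2 e2v' => w ee _.
  have ee' : e ^+ 2 = 1 by rewrite expr2.
  by field: ee'.
- move=> [y z] [_ /= sz].
  have q0 : 1 + dot y y != 0 by rewrite gt_eqF// dot1_gt0.
  rewrite /tstereo /tunstereo /=; set b := _ * dot z y.
  (* From here on [b] is an independent variable and [dot z y] is expressed through it, so the
     remaining claims are rational identities in [b] and [dot y y]. *)
  have zy : dot z y = b * (1 + dot y y) / 2 by rewrite /b; field.
  have zz : dot z z = 1 by [].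
  have ee : e ^+ 2 = 1 by rewrite expr2.
  clearbody b.
  rewrite unstereoK row_consK row_cons0 mulrN mulrA e2 mul1r scaleNr opprK subrK.
  split=> //; split; last first.
    by rewrite /cap/= unstereo_cap mulr_gt0// invr_gt0 dot1_gt0.
  apply/unit_tangent_sphereE; split=> /=; first exact: unstereo_sphere.
    rewrite dot_row row_consK row_cons0 row_consK row_cons0 !dotE (dotC y) zy.
    by field: ee.
  rewrite dot_row row_consK row_cons0 !dotE (dotC y) zy zz.
  by field: ee.
Qed.

End SphereManifold.

(** * Spheres and their unit tangent bundles as manifolds *)

Section Spheres.
Variable R : realType.

Lemma sphere0 (x : 'rV[R]_0) : ~ sphere R 0 x.
Proof. by rewrite /sphere/= /dot big_ord0 => /eqP; rewrite eq_sym oner_eq0. Qed.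

Lemma cap_cover n (x : 'rV[R]_n.+1) : exists2 e : R, e * e = 1 & cap e x.
Proof.
have [x0|x0] := ltP 0 (1 + x 0 0).
  by exists 1; rewrite ?mulr1// /cap/= mul1r.
exists (-1); first by rewrite mulrNN mulr1.
rewrite /cap/= mulN1r; lra.
Qed.

(** For [n = 0] the sphere is empty, its equation being [0 = 1], so the truncated dimension is
    harmless; otherwise the caps for [e = 1] and [e = -1] cover it. *)
Lemma sphere_manifold n : smooth_manifold n.-1 (sphere R n).
Proof.
case: n => [x /sphere0//|n]; apply: manifold_local => x _.
have [e ee cx] := cap_cover x.
by exists (cap e); split=> //; [exact: open_cap|exact: cap_manifold].
Qed.

(** The dimension is [2 n - 3] once [n] is at least 2. For smaller [n] there is no unit tangent
    vector, and truncated subtraction does no harm. *)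
Lemma unit_tangent_sphere_manifold n :
  smooth_manifold (n.-1 + n.-2) (unit_tangent_sphere R n).
Proof.
case: n => [[x v] [/sphere0]//|n]; apply: manifold_local => -[x v] _.
have [e ee cx] := cap_cover x.
exists [set z | cap e z.1]; split=> //; last first.
  by apply: unit_tangent_cap_manifold => //; exact: sphere_manifold.
have -> : [set z : 'rV[R]_n.+1 * 'rV[R]_n.+1 | cap e z.1] = cap e `*` setT.
  by apply/seteqP; split=> z; [split|case].
by apply: open_setX; [exact: open_cap|exact: openT].
Qed.

End Spheres.

(** * Diffeomorphisms between open intervals and the line *)

Section Iso.
Variable R : realType.
Implicit Types V W Z : normedModType R.

Lemma smooth_iso_trans V W Z (A : set V) (B : set W) (C : set Z) :
  findim V -> findim W -> findim Z ->
  smooth_iso A B -> smooth_iso B C -> smooth_iso A C.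
Proof.
move=> fV fW fZ [OV [OW [g [h [[oV oW AV BW] [sg sh gK hK]]]]]].
move=> [OW' [OZ [g' [h' [[oW' oZ BW' CZ] [sg' sh' gK' hK']]]]]].
exists (OV `&` g @^-1` OW'), (OZ `&` h' @^-1` OW), (fun x => g' (g x)),
  (fun z => h (h' z)).
have o1 : open (OV `&` g @^-1` OW') by exact: smooth_preimage_open.
have o2 : open (OZ `&` h' @^-1` OW) by exact: smooth_preimage_open.
split; split=> //.
- by move=> x Ax; split; [exact: AV|exact/BW'/(gK x Ax).1].
- by move=> x Cx; split; [exact: CZ|exact/BW/(hK' x Cx).1].
- apply: (@smooth_comp _ _ _ _ _ OW') => //; first by move=> x [].
  by apply: smoothS sg => x [].
- apply: (@smooth_comp _ _ _ _ _ OW) => //; first by move=> x [].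
  by apply: smoothS sh' => x [].
- move=> x Ax; have [Bg hg] := gK x Ax; have [Cg hg'] := gK' _ Bg.
  by rewrite hg' hg.
- move=> x Cx; have [Bg hg] := hK' x Cx; have [Cg hg'] := hK _ Bg.
  by rewrite hg' hg.
Qed.

Lemma smooth_iso_refl V (A : set V) : findim V -> smooth_iso A A.
Proof.
move=> fV; exists setT, setT, id, id; split; split=> //; try exact: openT;
  exact: smooth_linear.
Qed.

Lemma smooth_iso_prod V W V' W' (A : set V) (B : set W) (A' : set V') (B' : set W') :
  findim V -> findim W -> findim V' -> findim W' ->
  smooth_iso A B -> smooth_iso A' B' -> smooth_iso (A `*` A') (B `*` B').
Proof.
move=> fV fW fV' fW' [OV [OW [g [h [[oV oW AV BW] [sg sh gK hK]]]]]].
move=> [OV' [OW' [g' [h' [[oV' oW' AV' BW'] [sg' sh' gK' hK']]]]]].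
exists (OV `*` OV'), (OW `*` OW'), (fun z => (g z.1, g' z.2)),
  (fun z => (h z.1, h' z.2)); split; split; try exact: open_setX.
- by move=> x [/AV ? /AV' ?].
- by move=> x [/BW ? /BW' ?].
- exact: smooth_prod.
- exact: smooth_prod.
- move=> [x y] [/= Ax Ay]; have [? ->] := gK x Ax.
  by have [? ->] := gK' y Ay.
- move=> [x y] [/= Ax Ay]; have [? ->] := hK x Ax.
  by have [? ->] := hK' y Ay.
Qed.

Let posR := [set x : R | 0 < x].

Let oT : open [set: R]. Proof. exact: openT. Qed.
Let op : open posR. Proof. exact: open_gt. Qed.
Let sid (U : set R) : smooth_on U (fun x : R => x).
Proof. by apply: smooth_linear => //; exact: findim_R. Qed.

(** An algebraic substitute for the logarithm: [x - x^-1 = y] amounts to [x^2 - y x - 1 = 0], whose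
    roots have product -1, so exactly one is positive. *)
Lemma iso_pos_R : smooth_iso posR [set: R].
Proof.
have q4 (y : R) : 0 < y * y + 4 by rewrite ltr_wpDl// -expr2 sqr_ge0.
have sq (y : R) : `|y| < Num.sqrt (y * y + 4).
  by have q4y := q4 y; rewrite -sqrtr_sqr (ltr_sqrt (y ^+ 2) q4y) expr2 ltrDl.
exists posR, setT, (fun x : R => x - x^-1),
  (fun y : R => (y + Num.sqrt (y * y + 4)) * 2^-1).
split; split=> //.
- apply: smoothD => //; apply: smoothN => //; apply: smoothV => // x x0.
  by rewrite gt_eqF.
- apply: smoothM => //; last exact: smooth_cst.
  apply: smoothD => //.
  apply: (@smooth_comp _ _ _ _ _ posR) => //; first exact: findim_R.
    by move=> x _; exact: q4.
    by apply: smoothD => //; [exact: smoothM|exact: smooth_cst].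
  exact: smooth_sqrt.
- move=> x; rewrite /posR/= => x0; split=> //.
  have -> : (x - x^-1) * (x - x^-1) + 4 = (x + x^-1) ^+ 2.
    by field; rewrite gt_eqF.
  rewrite sqrtr_sqr ger0_norm; last by apply: addr_ge0; rewrite ?invr_ge0 ltW.
  by field; rewrite gt_eqF.
- move=> y _; have := sq y; set s := Num.sqrt _ => ys.
  have ss : s * s = y * y + 4 by rewrite -expr2 sqr_sqrtr// ltW.
  have y0 : 0 < y + s.
    by rewrite -ltrBlDl sub0r (le_lt_trans _ ys)// -normrN ler_norm.
  split; first by rewrite /posR/= mulr_gt0.
  have -> : ((y + s) * 2^-1)^-1 = (s - y) * 2^-1.
    have -> : s - y = 4 / (y + s).
      have E : (s - y) * (y + s) = 4.
        have -> : (s - y) * (y + s) = s * s - y * y by ring.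
        by rewrite ss; ring.
      by rewrite -E mulfK// gt_eqF.
    by field; rewrite gt_eqF.
  by field.
Qed.

Lemma open_not_min (X : set R) a : open X -> X a -> exists2 b, X b & b < a.
Proof.
move=> oX Xa; have /nbhs_ballP[e /= e0 eX] := open_nbhs_nbhs (conj oX Xa).
exists (a - e / 2); last by rewrite ltrBlDr ltrDl divr_gt0.
apply: eX; rewrite -ball_normE/= opprB addrC subrK ger0_norm ?divr_ge0 ?ltW//.
by rewrite ltr_pdivrMr// ltr_pMr// ltr1n.
Qed.

Lemma open_not_max (X : set R) a : open X -> X a -> exists2 b, X b & a < b.
Proof.
move=> oX Xa; have /nbhs_ballP[e /= e0 eX] := open_nbhs_nbhs (conj oX Xa).
exists (a + e / 2); last by rewrite ltrDl divr_gt0.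
apply: eX; rewrite -ball_normE/= opprD addrA subrr sub0r normrN.
rewrite ger0_norm ?divr_ge0 ?ltW//.
by rewrite ltr_pdivrMr// ltr_pMr// ltr1n.
Qed.

(** An open set contains neither its infimum nor its supremum, which leaves four shapes of interval.
    A bounded one is sent to the half-line by the Moebius map vanishing at [a] with its pole at [b],
    a half-line by an affine map. *)
Lemma iso_interval_R (X : set R) : open X -> is_interval X -> X !=set0 ->
  smooth_iso X [set: R].
Proof.
move=> oX iX X0.
have fR := findim_R R.
have infX : has_lbound X -> `[< X (inf X) >] = false.
  move=> lX; apply/asboolF => /(open_not_min oX)[b Xb].
  by apply/negP; rewrite -leNgt; exact: ge_inf.
have supX : has_ubound X -> `[< X (sup X) >] = false.
  move=> lX; apply/asboolF => /(open_not_max oX)[b Xb].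
  by apply/negP; rewrite -leNgt; exact: ub_le_sup.
have /is_intervalP := iX; rewrite /Rhull.
case: asboolP => [/infX ->|_]; case: asboolP => [/supX ->|_] XE; rewrite XE in oX X0 *.
- set a := inf X in oX X0 *; set b := sup X in oX X0 *; clearbody a b.
  apply: (smooth_iso_trans fR fR fR _ iso_pos_R).
  exists `]a, b[%classic, posR, (fun x => (x - a) * (b - x)^-1),
    (fun y => (a + b * y) * (1 + y)^-1); split; split=> //.
  + apply: smoothM => //; first by apply: smoothD => //; exact: smooth_cst.
    apply: smoothV => //.
      by move=> x /=; rewrite in_itv/= subr_eq0 => /andP[_ /gt_eqF->].
    by apply: smoothD => //; [exact: smooth_cst|exact: smoothN].
  + apply: smoothM => //.
      apply: smoothD => //; first exact: smooth_cst.
      by apply: smoothM => //; exact: smooth_cst.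
    apply: smoothV => //; first by move=> x x0; rewrite gt_eqF// addr_gt0.
    by apply: smoothD => //; exact: smooth_cst.
  + move=> x /=; rewrite in_itv/= => /andP[ax xb]; rewrite /posR/=.
    have bx : b - x != 0 by rewrite subr_eq0 gt_eqF.
    have ab : b - a != 0 by rewrite subr_eq0 gt_eqF// (lt_trans ax).
    split; first by rewrite mulr_gt0// ?invr_gt0 subr_gt0.
    by field; rewrite bx/=; apply: contra ab => /eqP E; apply/eqP; lra.
  + move=> y /= y0; have [z] := X0; rewrite /= in_itv/= => /andP[az zb].
    have ab := lt_trans az zb.
    have y1 : 0 < 1 + y by rewrite addr_gt0.
    have y1' : 1 + y != 0 by rewrite gt_eqF.
    split.
      rewrite in_itv/= ltr_pdivlMr// ltr_pdivrMr//; apply/andP; split.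
        by rewrite mulrDr mulr1 ltrD2l ltr_pM2r.
      by rewrite mulrDr mulr1 ltrD2r.
    field; rewrite y1'/=; have ba : b - a != 0 by rewrite subr_eq0 gt_eqF.
    by apply: contra ba => /eqP E; apply/eqP; lra.
- set a := inf X in oX X0 *; clearbody a.
  apply: (smooth_iso_trans fR fR fR _ iso_pos_R).
  exists `]a, +oo[%classic, posR, (fun x => x - a), (fun y => y + a).
  split; split=> //.
  + by apply: smoothD => //; exact: smooth_cst.
  + by apply: smoothD => //; exact: smooth_cst.
  + by move=> x /=; rewrite in_itv/= andbT /posR/= subr_gt0 subrK.
  + by move=> x /=; rewrite in_itv/= andbT /posR/= ltrDr addrK.
- set b := sup X in oX X0 *; clearbody b.
  apply: (smooth_iso_trans fR fR fR _ iso_pos_R).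
  exists `]-oo, b[%classic, posR, (fun x => b - x), (fun y => b - y).
  split; split=> //.
  + by apply: smoothD => //; [exact: smooth_cst|exact: smoothN].
  + by apply: smoothD => //; [exact: smooth_cst|exact: smoothN].
  + by move=> x /=; rewrite in_itv/= /posR/= subr_gt0 subKr.
  + by move=> x /=; rewrite in_itv/= /posR/= ltrBlDr ltrDl subKr.
- have -> : [set x : R | x \in `]-oo, +oo[] = setT.
    by apply/seteqP; split=> x //=; rewrite in_itv.
  exact: smooth_iso_refl.
Qed.

End Iso.

(** * Surfaces of rotation in the spacetime *)

Section Coordinates.
Variables (R : realType) (n : nat).
Local Notation E := (ambient R n).

Lemma findim_ambient : findim E.
Proof.
apply: findim_prod; last exact: findim_rV.
by apply: findim_prod; exact: findim_R.
Qed.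

Section SmoothCoordinates.
Variables (V : normedModType R) (U : set V).
Hypothesis oU : open U.

Lemma smooth_tc (g : V -> E) : smooth_on U g -> smooth_on U (fun x => tc (g x)).
Proof.
move=> sg; apply: (@smooth_linl _ _ E R^o _ (@tc R n)) => //.
exact: findim_ambient.
Qed.

Lemma smooth_rc (g : V -> E) : smooth_on U g -> smooth_on U (fun x => rc (g x)).
Proof.
move=> sg; apply: (@smooth_linl _ _ E R^o _ (@rc R n)) => //.
exact: findim_ambient.
Qed.

Lemma smooth_xic (g : V -> E) : smooth_on U g -> smooth_on U (fun x => xic (g x)).
Proof.
move=> sg; apply: (@smooth_linl _ _ E _ _ (@xic R n)) => //.
exact: findim_ambient.
Qed.

Lemma smooth_mkpt (a b : V -> R) (c : V -> 'rV[R]_n) :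
  smooth_on U a -> smooth_on U b -> smooth_on U c ->
  smooth_on U (fun x => mkpt (a x) (b x) (c x)).
Proof.
move=> sa sb sc; have fR := findim_R R.
apply: smooth_pair => //; [exact: findim_prod|exact: findim_rV|].
exact: smooth_pair.
Qed.

End SmoothCoordinates.

Section DeriveCoordinates.
Variables (c : R -> E) (s : R).
Hypothesis dc : differentiable c s.

Lemma derive_tc : 'D_1 (fun u => tc (c u)) s = tc ('D_1 c s).
Proof.
apply: (@derive_linear _ _ E R^o (@tc R n)) => //; exact: findim_ambient.
Qed.

Lemma derive_rc : 'D_1 (fun u => rc (c u)) s = rc ('D_1 c s).
Proof.
apply: (@derive_linear _ _ E R^o (@rc R n)) => //; exact: findim_ambient.
Qed.

Lemma derive_xic : 'D_1 (fun u => xic (c u)) s = xic ('D_1 c s).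
Proof.
apply: (@derive_linear _ _ E _ (@xic R n)) => //; exact: findim_ambient.
Qed.

Lemma differentiable_tc : differentiable (fun u => tc (c u)) s.
Proof.
apply: (@differentiable_comp _ _ _ _ c (@tc R n)) => //.
apply: (@smooth_differentiable _ _ _ setT) => //.
by apply: (@smooth_linear _ _ R^o) => //; exact: findim_ambient.
Qed.

Lemma differentiable_xic : differentiable (fun u => xic (c u)) s.
Proof.
apply: (@differentiable_comp _ _ _ _ c (@xic R n)) => //.
apply: (@smooth_differentiable _ _ _ setT) => //.
by apply: smooth_linear => //; exact: findim_ambient.
Qed.

End DeriveCoordinates.

(** When [S] contains whole spheres, the [(t, r)]-part and the angular part of a velocity can be
    realised independently: the planar curve [(a, b)] is paired with a curve from [sphere_curve]. *)
Lemma tangent_intro (S : set E) p v (B : set R) (a b : R -> R) :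
  open B -> B 0 -> smooth_on B a -> smooth_on B b ->
  a 0 = tc p -> b 0 = rc p -> 'D_1 a 0 = tc v -> 'D_1 b 0 = rc v ->
  sphere R n (xic p) -> dot (xic p) (xic v) = 0 ->
  (forall s xi, B s -> sphere R n xi -> S (mkpt (a s) (b s) xi)) ->
  tangent S p v.
Proof.
move=> oB B0 sa sb a0 b0 Da Db sp pv BS.
have [c [sc cS c0 Dc]] := sphere_curve sp pv.
have /nbhs_ballP[e /= e0 eB] := open_nbhs_nbhs (conj oB B0).
exists e, (fun s => mkpt (a s) (b s) (c s)); split=> //.
- apply: smooth_mkpt; first exact: ball_open.
  + exact: smoothS sa.
  + exact: smoothS sb.
  + exact: smoothS sc.
- by move=> s /eB Bs; exact: BS.
- by rewrite a0 b0 c0; case: p {a0 b0 Da Db sp pv c0 BS} => -[].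
have da := smooth_differentiable sa B0.
have db := smooth_differentiable sb B0.
have dc : differentiable c 0 by exact: smooth_differentiable sc _.
rewrite derive1E (derive_pair _ (differentiable_pair da db) dc).
rewrite (derive_pair _ da db) Da Db Dc.
by case: v {Da Db pv Dc} => -[].
Qed.

Lemma tangent_xic (S : set E) p v : (forall q, S q -> sphere R n (xic q)) ->
  tangent S p v -> dot (xic p) (xic v) = 0.
Proof.
move=> Ssph [e [c [e0 sc cS <- <-]]]; rewrite derive1E.
have dc := smooth_differentiable sc (ballxx 0 e0).
rewrite -derive_xic//; apply: derive_sphere; first exact: differentiable_xic.
by exists e => // u /cS/Ssph.
Qed.

Lemma smooth_affine (a b : R) (U : set R) : open U ->
  smooth_on U (fun s => a + b * s).
Proof.
move=> oU; apply: smoothD => //; first exact: smooth_cst.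
apply: smoothM => //; first exact: smooth_cst.
by apply: smooth_linear => //; exact: findim_R.
Qed.

Lemma derive_affine (a b s : R) : 'D_1 (fun s : R => a + b * s) s = b.
Proof.
rewrite deriveD; [|exact: derivable_cst|exact: derivableM].
rewrite derive_cst deriveM// derive_cst derive_id /GRing.scale/=.
by rewrite mulr1 mulr0 addr0 add0r.
Qed.

Lemma derive_chain (u rho : R -> R) s :
  differentiable u s -> differentiable rho (u s) ->
  'D_1 (fun x => rho (u x)) s = 'D_1 u s * 'D_1 rho (u s).
Proof.
move=> du dr.
have du1 : derivable u s 1 by exact/derivable1_diffP.
have dr1 : derivable rho (u s) 1 by exact/derivable1_diffP.
by have := derive1_comp du1 dr1; rewrite !derive1E mulrC.
Qed.

Lemma open_preimage_affine (a b : R) (T : set R) : open T ->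
  open ((fun s => a + b * s) @^-1` T).
Proof.
move=> oT; rewrite -[X in open X]setTI.
apply: smooth_preimage_open => //; first exact: openT.
exact/smooth_affine/openT.
Qed.

Lemma tangent_spacetime (I : set R) (p v : E) : open I -> spacetime I p ->
  tangent (spacetime I) p v <-> dot (xic p) (xic v) = 0.
Proof.
move=> oI [Ip sp]; split; first by apply: tangent_xic => q [].
move=> pv; pose B := (fun s => rc p + rc v * s) @^-1` I.
have oB : open B by exact: open_preimage_affine.
apply: (@tangent_intro _ _ _ B (fun s => tc p + tc v * s)
  (fun s => rc p + rc v * s)) => //; rewrite ?mulr0 ?addr0 ?derive_affine//.
- by rewrite /B/= mulr0 addr0.
- exact: smooth_affine.
- exact: smooth_affine.
Qed.

Definition rotation_surface (T : set R) (rho : R -> R) : set E :=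
  [set p | [/\ T (tc p), rc p = rho (tc p) & sphere R n (xic p)]].

Lemma tangent_rotation_surface T rho p v : open T -> smooth_on T rho ->
  rotation_surface T rho p ->
  tangent (rotation_surface T rho) p v <->
  rc v = tc v * 'D_1 rho (tc p) /\ dot (xic p) (xic v) = 0.
Proof.
move=> oT srho [Tp rp sp]; split=> [tv|[rv pv]].
  split; last by apply: tangent_xic tv => q [].
  have [e [c [e0 sc cS c0 Dc]]] := tv; rewrite -c0 in Tp *.
  rewrite -Dc derive1E.
  have dc := smooth_differentiable sc (ballxx 0 e0).
  rewrite -derive_rc// -derive_tc//.
  rewrite -(derive_chain (differentiable_tc dc) (smooth_differentiable srho Tp)).
  apply: near_eq_derive; exists e => // s /cS[_ + _].
  by [].
pose B := (fun s => tc p + tc v * s) @^-1` T.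
have oB : open B by exact: open_preimage_affine.
have t0 : tc p + tc v * 0 = tc p by rewrite mulr0 addr0.
have sa := smooth_affine (tc p) (tc v) oB.
apply: (@tangent_intro _ _ _ B (fun s => tc p + tc v * s)
  (fun s => rho (tc p + tc v * s))) => //.
- by rewrite /B/= t0.
- by apply: (@smooth_comp _ _ _ _ _ T) => //; exact: findim_R.
- by rewrite t0 rp.
- exact: derive_affine.
have B0 : B 0 by rewrite /B/= t0.
have da := smooth_differentiable sa B0.
have dr := smooth_differentiable srho B0.
by rewrite (derive_chain da dr) t0 derive_affine.
Qed.

End Coordinates.

(** * Lifted null bundles of surfaces of rotation *)

Section Lift.
Variables (R : realType) (n : nat) (I : set R) (f : R -> R).
Hypothesis LS : classS I f.
Local Notation E := (ambient R n).

Let oI : open I. Proof. by case: LS. Qed.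
Let I_gt0 r : I r -> 0 < r. Proof. by case: LS => _ _ /(_ r). Qed.
Let sf : smooth_on I f. Proof. by case: LS. Qed.
Let f_gt0 r : I r -> 0 < f r. Proof. by case: LS => _ _ _ _ /(_ r). Qed.

Lemma metric_dt (p v : E) : metric f p v (dt R n) = - f (rc p) * tc v.
Proof.
by rewrite /metric /dt /mkpt /tc /rc /xic /= dot0r !mulr0 !addr0 mulr1.
Qed.

(* [e = 1] gives the future null bundle and [e = -1] the past one. *)
Definition null_bundle (e : R) (P : set E) : set (E * E) :=
  [set z | [/\ P z.1, tangent P z.1 z.2, null_vector f z.1 z.2 & 0 < e * tc z.2]].

(** Since [g(v, dt) = - f * tc v] with [f] positive, time orientation is the sign of [tc v]; the
    sign [e] lets one argument treat both bundles. *)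
Lemma null_bundle_time_oriented (P : set E) N : P `<=` spacetime I ->
  N = future_null_bundle f P \/ N = past_null_bundle f P ->
  exists2 e : R, e * e = 1 & N = null_bundle e P.
Proof.
move=> PS N_eq.
have fut p v : P p -> future_directed f p v = (0 < tc v) :> Prop.
  move=> /PS[/f_gt0 fp _].
  by rewrite /future_directed metric_dt mulNr oppr_lt0 pmulr_rgt0.
have past p v : P p -> past_directed f p v = (0 < - tc v) :> Prop.
  move=> /PS[/f_gt0 fp _].
  by rewrite /past_directed metric_dt mulNr !oppr_gt0 pmulr_rlt0.
case: N_eq => ->; [exists 1|exists (-1)]; rewrite ?mulrNN ?mulr1//.
  apply/seteqP; split=> z [Pz tz nz]; rewrite /= ?(fut _ _ Pz) ?mul1r => ?;
    by split=> //; rewrite ?(fut _ _ Pz) ?mul1r.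
apply/seteqP; split=> z [Pz tz nz]; rewrite /= ?(past _ _ Pz) ?mulN1r => ?;
  by split=> //; rewrite ?(past _ _ Pz) ?mulN1r.
Qed.

Lemma pairing_metricP (p a X : E) : spacetime I p ->
  dot (xic p) (xic a) = 0 -> dot (xic p) (xic X) = 0 ->
  (forall w, tangent (spacetime I) p w -> pairing a w = metric f p X w) <->
  [/\ tc a = - f (rc p) * tc X, rc a = (f (rc p))^-1 * rc X &
      xic a = rc p ^+ 2 *: xic X].
Proof.
move=> Sp pa pX; split=> [H|[at_ ar ax] w _]; last first.
  by rewrite /pairing /metric at_ ar ax dotZl !mulrA.
have T w : dot (xic p) (xic w) = 0 -> pairing a w = metric f p X w.
  by move=> pw; apply: H; exact/tangent_spacetime.
split.
- have := T (mkpt 1 0 0); rewrite /pairing /metric /mkpt /tc /rc /xic /=.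
  by rewrite !dot0r !mulr0 !addr0 !mulr1; exact.
- have := T (mkpt 0 1 0); rewrite /pairing /metric /mkpt /tc /rc /xic /=.
  by rewrite !dot0r !mulr0 !addr0 !add0r !mulr1; exact.
(* The difference of the two angular parts is itself tangent to the sphere, hence an admissible test
   vector; tested against itself it has length zero. *)
pose d := xic a - rc p ^+ 2 *: xic X.
have pd : dot (xic p) d = 0 by rewrite /d !dotE pa pX mulr0 subr0.
have := T (mkpt 0 0 d) pd; rewrite /pairing /metric /mkpt /tc /rc /xic /=.
rewrite !mulr0 !add0r => E1; apply/eqP; rewrite -subr_eq0; apply/eqP.
apply: dot_eq0; rewrite -/(xic a) -/(xic X) -/(rc p) -/d.
by rewrite {1}/d dotDl dotNl dotZl -E1 subrr.
Qed.

Variables (T : set R) (rho : R -> R).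
Hypotheses (oT : open T) (srho : smooth_on T rho)
  (Trho : forall t, T t -> I (rho t)).

Let P : set E := rotation_surface T rho.

Lemma rotation_surface_sub : P `<=` spacetime I.
Proof. by move=> p [Tp rp sp]; split=> //; rewrite rp; exact: Trho. Qed.

Variable e : R.
Hypothesis ee : e * e = 1.

(** Minus the square of the vector [(1, rho', 0)] tangent to the surface: positive if this vector is
    timelike, zero if it is null. *)
Definition causal_gap (t : R) : R := f (rho t) - ('D_1 rho t) ^+ 2 / f (rho t).

(** Inverting the metric isomorphism eliminates the quantified vector and leaves explicit equations
    in the coordinates of [z]. The last one is the null condition, and the sign of [e * tc z.2] is
    reversed because the [dt^2] coefficient is [- f]. *)
Lemma cotangent_liftE (z : E * E) :
  cotangent_lift I f (null_bundle e P) z <->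
  [/\ T (tc z.1), rc z.1 = rho (tc z.1), sphere R n (xic z.1) &
      dot (xic z.1) (xic z.2) = 0] /\
  [/\ e * tc z.2 < 0,
      rc z.2 = - tc z.2 * 'D_1 rho (tc z.1) / f (rho (tc z.1)) ^+ 2 &
      dot (xic z.2) (xic z.2) = rho (tc z.1) ^+ 2
        * (tc z.2 / f (rho (tc z.1))) ^+ 2 * causal_gap (tc z.1)].
Proof.
case: z => p a /=; split.
  move=> [/= [/= Sp]] /(tangent_spacetime _ oI Sp) pa [X [[/= Pp tX [_ nX] eX]]].
  have [Tp rp sp] := Pp.
  have /(tangent_rotation_surface _ oT srho Pp)[rX pX] := tX.
  move=> /(pairing_metricP Sp pa pX)[aE rE xE].
  have f0 : f (rho (tc p)) != 0 by rewrite gt_eqF// f_gt0//; exact: Trho.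
  have r0 : rho (tc p) != 0 by rewrite gt_eqF// I_gt0//; exact: Trho.
  split=> //; rewrite aE rE xE rX rp; split.
  - by rewrite mulNr mulrN oppr_lt0 mulrCA mulr_gt0//; apply: f_gt0; exact: Trho.
  - by field.
  - rewrite dotZl dotZr.
    move: nX; rewrite /metric rp rX => nX.
    have -> : rho (tc p) ^+ 2 * dot (xic X) (xic X)
        = tc X ^+ 2 * causal_gap (tc p).
      rewrite /causal_gap; apply/eqP; rewrite -subr_eq0; apply/eqP.
      by rewrite -[RHS]nX; field.
    by rewrite /causal_gap; field.
move=> [[Tp rp sp pa] [ea ra aa]].
have Pp : P p by split.
have Sp := rotation_surface_sub Pp.
have f1 : 0 < f (rho (tc p)) by apply: f_gt0; exact: Trho.
have f0 : f (rho (tc p)) != 0 by rewrite gt_eqF.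
have r0 : rho (tc p) != 0 by rewrite gt_eqF// I_gt0//; exact: Trho.
split; first by split=> //; exact/(tangent_spacetime _ oI Sp).
(* The vector dual to [a]: its [t]- and angular components are obtained by dividing by the metric
   coefficients, its [r]-component is the one forced by tangency. *)
pose tau := - tc a / f (rho (tc p)).
pose X : E := mkpt tau (tau * 'D_1 rho (tc p)) ((rho (tc p) ^+ 2)^-1 *: xic a).
have pX : dot (xic p) (xic X) = 0 by rewrite /= dotZr pa mulr0.
have tau0 : 0 < e * tau.
  by rewrite /tau mulrA mulrN divr_gt0// oppr_gt0.
exists X; split; last first.
  apply/(pairing_metricP Sp pa pX); rewrite rp; split.
  - by rewrite /X /tau /tc /=; field.
  - by rewrite ra /X /tau /rc /=; field.
  - by rewrite /X /xic /= scalerA divff ?scale1r// expf_neq0.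
split=> //.
  exact/(tangent_rotation_surface _ oT srho Pp).
split.
  move=> /= X0; move: tau0; have -> : tau = tc X by [].
  by rewrite X0 /tc/= mulr0 ltxx.
rewrite /metric rp -[tc X]/tau -[rc X]/(tau * _) -[xic X]/(_ *: _).
rewrite dotZl dotZr aa /causal_gap /tau.
by field; rewrite f0 r0.
Qed.

Let fR := findim_R R.
Let fn := findim_rV R n.
Let fE := findim_ambient R n.

Let sfr : smooth_on T (fun t => f (rho t)).
Proof. by apply: (@smooth_comp _ _ _ _ _ I). Qed.

Let fr_neq0 t : T t -> f (rho t) != 0.
Proof. by move=> Tt; rewrite gt_eqF// f_gt0//; exact: Trho. Qed.

Let sD : smooth_on T (fun t => 'D_1 rho t).
Proof. exact: smooth_derive. Qed.

Let sgap : smooth_on T causal_gap.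
Proof.
apply: smoothD => //; apply: smoothN => //; apply: smoothM => //.
  exact: smoothM.
exact: smoothV.
Qed.

Let posR := [set x : R | 0 < x].

(** An open neighbourhood of the lift on which all chart formulas are smooth: [rho] is controlled on
    [T] only, and the sign condition keeps [energy] positive. *)
Let OV : set (E * E) := [set z | T (tc z.1) /\ e * tc z.2 < 0].

Let stc1 U : open U -> smooth_on U (fun z : E * E => tc z.1).
Proof. by move=> oU; apply: smooth_tc => //; exact: smooth_fst. Qed.

Let stc2 U : open U -> smooth_on U (fun z : E * E => tc z.2).
Proof. by move=> oU; apply: smooth_tc => //; exact: smooth_snd. Qed.

Let oV : open OV.
Proof.
have oTT : open [set: (E * E)%type] by exact: openT.
have -> : OV = setT `&` (fun z : E * E => (tc z.1, e * tc z.2)) @^-1`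
    (T `*` [set x | x < 0]) by rewrite setTI.
apply: smooth_preimage_open => //.
  by apply: open_setX => //; exact: open_lt.
apply: smooth_pair => //; first exact: stc1.
by apply: smoothM => //; [exact: smooth_cst|exact: stc2].
Qed.

Let sT (h : R -> R) : smooth_on T h -> smooth_on OV (fun z => h (tc z.1)).
Proof.
move=> sh; apply: (@smooth_comp _ _ _ _ _ T) => //; first by move=> z [].
exact: stc1.
Qed.

(** This is [e] times the [t]-component of the vector dual to the covector [z.2]. *)
Let energy (z : E * E) : R := - (e * tc z.2) / f (rho (tc z.1)).

Let senergy : smooth_on OV energy.
Proof.
apply: smoothM => //.
  apply: smoothN => //; apply: smoothM => //; first exact: smooth_cst.
  exact: stc2.
by apply: smoothV => //; [move=> z [Tz _]; exact: fr_neq0|exact: (sT sfr)].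
Qed.

Let energy_gt0 z : OV z -> 0 < energy z.
Proof.
by move=> [Tz ez]; rewrite divr_gt0 ?oppr_gt0// f_gt0//; exact: Trho.
Qed.

Let OW (V : normedModType R) : set (V * (R * R)) := setT `*` (T `*` setT).

Let oW V : open (@OW V).
Proof. by do 2?apply: open_setX => //; exact: openT. Qed.

Let sT' (V : normedModType R) (h : R -> R) : findim V -> smooth_on T h ->
  smooth_on (@OW V) (fun w => h w.2.1).
Proof.
move=> fV sh; have fRR := findim_prod fR fR.
apply: (@smooth_comp _ _ _ _ _ T) => //.
- exact: oW.
- by move=> w [_ []].
- by apply: (@smooth_linear _ _ R^o) => //; exact: findim_prod.
Qed.

Let sS' (V : normedModType R) : findim V ->
  smooth_on (@OW V) (fun w => w.2.2).
Proof.
move=> fV; have fRR := findim_prod fR fR.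
by apply: (@smooth_linear _ _ R^o) => //; exact: findim_prod.
Qed.

Let base (t : R) (xi : 'rV[R]_n) : E := mkpt t (rho t) xi.
(** The dual of a vector tangent to the surface with [t]-component [e * s]; its first two components
    are determined by [t] and [s], only the angular part is free. *)
Let covector (t s : R) (alpha : 'rV[R]_n) : E :=
  mkpt (- (e * s) * f (rho t)) (e * s * 'D_1 rho t / f (rho t)) alpha.

Let slift (V : normedModType R) (x a : V * (R * R) -> 'rV[R]_n) : findim V ->
  smooth_on (@OW V) x -> smooth_on (@OW V) a ->
  smooth_on (@OW V) (fun w => (base w.2.1 (x w), covector w.2.1 w.2.2 (a w))).
Proof.
move=> fV sx sa.
have oU := @oW V.
have st : smooth_on T (fun t => t) by exact: (@smooth_linear _ _ R^o).
have ses : smooth_on (@OW V) (fun w => e * w.2.2).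
  by apply: smoothM => //; [exact: smooth_cst|exact: sS'].
apply: smooth_pair => //; apply: smooth_mkpt => //.
- exact: (sT' fV st).
- exact: (sT' fV srho).
- by apply: smoothM => //; [exact: smoothN|exact: (sT' fV sfr)].
apply: smoothM => //; first by apply: smoothM => //; exact: (sT' fV sD).
apply: smoothV => //; last exact: (sT' fV sfr).
by move=> w [_ [Tw _]]; exact: fr_neq0.
Qed.

Let e2 : e ^+ 2 = 1. Proof. by rewrite expr2. Qed.

Let energyK t s xi a : T t -> energy (base t xi, covector t s a) = s.
Proof.
move=> Tt; have f0 := fr_neq0 Tt.
by rewrite /energy /base /covector /tc /rc /=; field: e2.
Qed.

Let covectorK z : OV z -> rc z.2 = - tc z.2 * 'D_1 rho (tc z.1) / f (rho (tc z.1)) ^+ 2 ->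
  covector (tc z.1) (energy z) (xic z.2) = z.2.
Proof.
move=> [Tz _] rz; have f0 := fr_neq0 Tz.
rewrite /covector /energy mulrA mulrN mulrA ee mul1r.
case: z rz Tz f0 => z [[a b] x] /=; rewrite /tc /rc /xic /= => -> Tz f0.
by congr (_, _, _); field.
Qed.

Let lift := cotangent_lift I f (null_bundle e P).

Let lift_OV z : lift z -> OV z.
Proof. by move=> /cotangent_liftE[[? _ _ _] [? _ _]]. Qed.

Let covector_lt0 t s a : T t -> 0 < s -> e * tc (covector t s a) < 0.
Proof.
move=> Tt s0; rewrite /covector /tc /= mulNr mulrN oppr_lt0 !mulrA ee mul1r.
by rewrite mulr_gt0// f_gt0//; exact: Trho.
Qed.

Let covector_rc t s a : T t -> rc (covector t s a) =
  - tc (covector t s a) * 'D_1 rho t / f (rho t) ^+ 2.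
Proof. by move=> /fr_neq0 f0; rewrite /covector /rc /tc /=; field. Qed.

Let gapE t s a : T t -> rho t ^+ 2 * (tc (covector t s a) / f (rho t)) ^+ 2
  * causal_gap t = s ^+ 2 * (rho t ^+ 2 * causal_gap t).
Proof.
move=> /fr_neq0 f0; rewrite /covector /tc /= mulfK// sqrrN exprMn (expr2 e) ee.
by ring.
Qed.

Lemma timelike_lift_iso : (forall t, T t -> 0 < causal_gap t) ->
  smooth_iso lift (unit_tangent_sphere R n `*` (T `*` posR)).
Proof.
move=> gap0.
(* By [cotangent_liftE] the angular part of a covector in the lift has length
   [energy z * m (tc z.1)], so dividing by this yields a unit vector. Positivity of the gap keeps
   the square root smooth and the divisor nonzero. *)
pose m t := rho t * Num.sqrt (causal_gap t).
have m0 t : T t -> 0 < m t.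
  by move=> Tt; rewrite mulr_gt0 ?sqrtr_gt0 ?gap0// I_gt0//; exact: Trho.
have m2 t : T t -> m t ^+ 2 = rho t ^+ 2 * causal_gap t.
  by move=> Tt; rewrite exprMn sqr_sqrtr// ltW// gap0.
have sm : smooth_on T m.
  apply: smoothM => //; apply: (@smooth_comp _ _ _ _ _ posR).
  - exact: fR.
  - exact: oT.
  - exact: open_gt.
  - by move=> t /gap0.
  - exact: sgap.
  - exact: smooth_sqrt.
exists OV, (@OW ('rV[R]_n * 'rV[R]_n)%type),
  (fun z => ((xic z.1, (energy z * m (tc z.1))^-1 *: xic z.2), (tc z.1, energy z))),
  (fun w => (base w.2.1 w.1.1, covector w.2.1 w.2.2 ((w.2.2 * m w.2.1) *: w.1.2))).
have fnn := findim_prod fn fn.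
have oU := @oW ('rV[R]_n * 'rV[R]_n)%type.
split; first by split=> // w [_ [Tw _]].
split.
- apply: smooth_pair => //; [exact: findim_prod| |].
    apply: smooth_pair => //; first by apply: smooth_xic => //; exact: smooth_fst.
    apply: smoothZ => //; last by apply: smooth_xic => //; exact: smooth_snd.
    apply: smoothV => //; last by apply: smoothM => //; exact: sT.
    move=> z Oz; have [Tz _] := Oz.
    by rewrite gt_eqF// mulr_gt0 ?energy_gt0// m0.
  by apply: smooth_pair => //; exact: stc1.
- have fV3 := findim_prod fnn (findim_prod fR fR).
  apply: (@slift _ (fun w => w.1.1) (fun w => (w.2.2 * m w.2.1) *: w.1.2)) => //.
    exact: smooth_linear.
  apply: smoothZ => //; last exact: smooth_linear.
  by apply: smoothM => //; [exact: sS'|exact: sT'].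
- move=> z Lz; have Oz := lift_OV Lz; have e0 := energy_gt0 Oz.
  have /cotangent_liftE[[Tz rz sz xa] [ez rz2 az]] := Lz.
  have mz := m0 _ Tz; have em0 : energy z * m (tc z.1) != 0.
    by rewrite mulf_neq0// gt_eqF.
  have ze : tc z.2 / f (rho (tc z.1)) = - (e * energy z).
    by rewrite /energy !mulNr mulrN opprK !mulrA ee mul1r.
  split; last first.
    rewrite /= scalerA divff// scale1r covectorK//.
    by rewrite /base -rz; case: z {Lz Oz e0 Tz rz sz xa ez rz2 az mz em0 ze} => -[[]].
  split=> //; apply/unit_tangent_sphereE; split=> //=.
    by rewrite dotZr xa mulr0.
  rewrite dotZl dotZr; have -> : dot (xic z.2) (xic z.2) = (energy z * m (tc z.1)) ^+ 2.
    by rewrite [RHS]exprMn m2// az ze sqrrN exprMn e2; ring.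
  by move: (energy z * m (tc z.1)) em0 => q q0; field.
- move=> [[x z] [t s]] [/= /unit_tangent_sphereE[/= xx xz zz] [Tt s0]].
  have mt := m0 _ Tt; have sm0 : s * m t != 0 by rewrite mulf_neq0// gt_eqF.
  split; last by rewrite energyK// scalerA mulVf// scale1r.
  apply/cotangent_liftE; split; split=> //=.
  + by rewrite dotZr xz mulr0.
  + exact: covector_lt0.
  + exact: covector_rc.
  + rewrite gapE// -m2// dotZl dotZr zz.
    by ring.
Qed.

Lemma null_lift_iso : (forall t, T t -> causal_gap t = 0) ->
  smooth_iso lift (sphere R n `*` (T `*` posR)).
Proof.
move=> gap0.
exists OV, (@OW 'rV[R]_n), (fun z => (xic z.1, (tc z.1, energy z))),
  (fun w => (base w.2.1 w.1, covector w.2.1 w.2.2 0)).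
have oU := @oW 'rV[R]_n.
split; first by split=> // w [_ [Tw _]].
split.
- apply: smooth_pair => //; [exact: findim_prod| |].
    by apply: smooth_xic => //; exact: smooth_fst.
  by apply: smooth_pair => //; exact: stc1.
- have fV3 := findim_prod fn (findim_prod fR fR).
  apply: (@slift _ (fun w => w.1) (fun=> 0)) => //; last exact: smooth_cst.
  exact: smooth_linear.
- move=> z Lz; have Oz := lift_OV Lz; have e0 := energy_gt0 Oz.
  have /cotangent_liftE[[Tz rz sz xa] [ez rz2 az]] := Lz.
  split=> //; have a0 : xic z.2 = 0 by apply: dot_eq0; rewrite az gap0// mulr0.
  rewrite -[X in covector _ _ X]a0 /= covectorK//.
  by rewrite /base -rz; case: z {Lz Oz e0 Tz rz sz xa ez rz2 az a0} => -[[]].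
- move=> [x [t s]] [/= xx [Tt s0]].
  split; last by rewrite energyK.
  apply/cotangent_liftE; split; split=> //=.
  + by rewrite dot0r.
  + exact: covector_lt0.
  + exact: covector_rc.
  + by rewrite gap0// mulr0 dot0r.
Qed.

Hypotheses (iT : is_interval T) (T0 : T !=set0).

(** For the manifold structure [T] and [posR] serve as they are, being open in the line; for the
    topology both are stretched to the whole line. *)
Lemma lift_conclusion (V : normedModType R) k (K : set V) : findim V ->
  smooth_manifold k K -> smooth_iso lift (K `*` (T `*` posR)) ->
  (exists k, smooth_submanifold (phase_space n I) k lift) /\
  homeomorphic lift (K `*` [set: R * R]).
Proof.
move=> fV mK isoL.
have fRR := findim_prod fR fR; have fVR := findim_prod fV fRR.
have fEE := findim_prod fE fE.
have isoR : smooth_iso (T `*` posR) [set: R * R].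
  have -> : [set: R * R] = [set: R] `*` [set: R].
    by apply/seteqP; split.
  by apply: smooth_iso_prod => //; [exact: iso_interval_R|exact: iso_pos_R].
have isoK : smooth_iso (K `*` (T `*` posR)) (K `*` [set: R * R]).
  by apply: smooth_iso_prod => //; exact: smooth_iso_refl.
have iso := smooth_iso_trans fEE fVR fVR isoL isoK.
split; last exact: homeomorphic_iso.
exists (k + (1 + 1))%N; split; first by move=> z [].
apply: manifold_iso isoL _ => //.
apply: manifold_prod => //; apply: manifold_prod => //; apply: open_manifold_R => //.
Qed.

End Lift.

(** * Photon surfaces and principal null hypersurfaces as surfaces of rotation *)

Section Hypersurfaces.
Variables (R : realType) (n : nat) (I : set R) (f : R -> R).
Hypothesis LS : classS I f.
Local Notation E := (ambient R n).

Let f_gt0 r : I r -> 0 < f r. Proof. by case: LS => _ _ _ _ /(_ r). Qed.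
Let I_gt0 r : I r -> 0 < r. Proof. by case: LS => _ _ /(_ r). Qed.

Lemma sph_sym_rotation_surface (P : set E) : sph_sym_photon_surface I f P ->
  exists T rho, P = rotation_surface T rho /\
    [/\ open T, smooth_on T rho, forall t, T t -> I (rho t),
        is_interval T & T !=set0] /\
    forall t, T t -> 0 < causal_gap f rho t.
Proof.
move=> [[[[PS _] Ptime] _] [p0 Pp0] cP Psec].
pose T : set R := (@tc R n) @` P.
(* The radius of the slice at time [t], picked by choice; the default 0 can only occur outside
   [T]. *)
pose rho t := xget 0 [set r | I r /\
  P `&` [set p | tc p = t] = [set p | [/\ tc p = t, rc p = r & sphere R n (xic p)]]].
have rhoP t : T t -> I (rho t) /\
    P `&` [set p | tc p = t] = [set p | [/\ tc p = t, rc p = rho t & sphere R n (xic p)]].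
  move=> [p Pp pt]; rewrite /rho; case: xgetP => [r _ //|].
  have [|r Ir Pr] := Psec t; first by exists p.
  by move=> /(_ r); case.
have PE : P = rotation_surface T rho.
  apply/seteqP; split=> p.
    move=> Pp; have Tp : T (tc p) by exists p.
    have [_ secE] := rhoP _ Tp.
    have : (P `&` [set q | tc q = tc p]) p by split.
    by rewrite secE => -[].
  move=> [Tp rp sp]; have [_ secE] := rhoP _ Tp.
  have : [set q | [/\ tc q = tc p, rc q = rho (tc p) & sphere R n (xic q)]] p.
    by split.
  by rewrite -secE => -[].
have tcv p v : P p -> metric f p v v < 0 -> tc v != 0.
  move=> /PS[Ip _]; apply: contraTneq => v0; rewrite -leNgt /metric v0 !mulr0 add0r.
  have fi : 0 <= (f (rc p))^-1 by rewrite invr_ge0 ltW// f_gt0.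
  have rr : 0 <= rc v * rc v by rewrite -expr2 sqr_ge0.
  by apply: addr_ge0; rewrite mulr_ge0 ?sqr_ge0 ?dot_ge0.
(* Along a curve of [P] with timelike velocity at [p], the time is a valid parameter near [p], and
   [r] equals [rho] of the time because the curve stays in [P]. So [smooth_reparam] gives at once
   that [T] is a neighbourhood of [t] and that [rho] is smooth there. *)
have loc t : T t -> exists B : set R, [/\ open B, B t, B `<=` T & smooth_on B rho].
  move=> [p Pp <-]; have [v [[e [c [e0 sc cP' c0 Dc]]] mv _]] := Ptime p Pp.
  have sdc s : ball (0 : R) e s -> differentiable c s by exact: smooth_differentiable.
  have oball : open (ball (0 : R) e) by exact: ball_open.
  pose u s := tc (c s).
  have su : smooth_on (ball 0 e) u by exact: smooth_tc.
  have sDu := smooth_derive (1 : R) su.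
  pose A := ball 0 e `&` (fun s => 'D_1 u s) @^-1` [set x : R | x != 0].
  have oA : open A by apply: smooth_preimage_open => //; exact: open_neq.
  have A0 : A 0.
    split; first exact: ballxx.
    rewrite /= /u derive_tc; last by apply: sdc; exact: ballxx.
    by rewrite -derive1E Dc; exact: tcv mv.
  have AS : A `<=` ball 0 e by move=> s [].
  have [oB sB] := @smooth_reparam R R A u (fun s => rc (c s)) rho oA (smoothS AS su)
    (fun s As => As.2) (smoothS AS (smooth_rc oball sc))
    (fun s As => ltac:(by have := cP' s As.1; rewrite PE => -[])).
  exists (u @` A); split=> //; first by exists 0 => //; rewrite /u c0.
  by move=> _ [s [Bs _] <-]; exists (c s) => //; exact: cP'.
have oT : open T.
  rewrite openE => t /loc[B [oB Bt BT _]].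
  by apply: filterS BT _; exact: open_nbhs_nbhs.
have sT : smooth_on T rho.
  by apply: smooth_local => t /loc[B [? ? _ ?]]; exists B.
exists T, rho; split=> //; split.
  split=> //; first by move=> t /rhoP[].
    apply/connected_intervalP; apply: connected_continuous_connected => //.
    apply: continuous_in_subspaceT => p _.
    apply: (@smooth_continuous _ _ _ setT) => //.
    by apply: (@smooth_linear _ _ R^o) => //; exact: findim_ambient.
  by exists (tc p0), p0.
move=> _ [p Pp <-].
have Pp' : rotation_surface T rho p by rewrite -PE.
have [v [tv mv _]] := Ptime p Pp; have v0 := tcv p v Pp mv.
move: tv; rewrite PE => /(tangent_rotation_surface _ oT sT Pp')[rv _].
have [Tp rp _] := Pp'.
have fp : f (rho (tc p)) != 0 by rewrite gt_eqF// f_gt0//; exact: (rhoP _ Tp).1.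
have tv2 : 0 < tc v ^+ 2 by rewrite lt_def sqr_ge0 sqrf_eq0 v0.
(* For [v] tangent to the surface, [g(v, v)] is [rc p ^ 2 |xic v| ^ 2 - tc v ^ 2 * causal_gap]. As
   this is negative and its first term is not, the gap is positive. *)
rewrite -(pmulr_rgt0 _ tv2).
have d0 : 0 <= rc p ^+ 2 * dot (xic v) (xic v) by rewrite mulr_ge0 ?sqr_ge0 ?dot_ge0.
apply: le_lt_trans d0 _; rewrite -subr_gt0 -oppr_lt0.
apply: le_lt_trans mv; rewrite le_eqVlt; apply/orP; left; apply/eqP.
by rewrite /metric rv rp /causal_gap; field.
Qed.

(** The angular velocity vanishes, so by nullity a zero of [t'] would be a zero of [r'] and of the
    whole velocity, which is excluded. Hence [t] is injective along the geodesic and [r] becomes a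
    smooth function of it. *)
Lemma principal_rotation_surface (J : set R) (gamma : R -> E) :
  principal_null_geodesic I f J gamma ->
  exists T rho, generated_hypersurface J gamma = rotation_surface T rho /\
    [/\ open T, smooth_on T rho, forall t, T t -> I (rho t),
        is_interval T & T !=set0] /\
    forall t, T t -> causal_gap f rho t = 0.
Proof.
move=> [[[oJ iJ [s1 Js1] sg [gS _]] gnull] gang].
have dg s : J s -> differentiable gamma s by exact: smooth_differentiable.
pose u s := tc (gamma s); pose g s := rc (gamma s).
have su : smooth_on J u by exact: smooth_tc.
have sg' : smooth_on J g by exact: smooth_rc.
have Du s : J s -> 'D_1 u s = tc ('D_1 gamma s) by move=> Js; exact/derive_tc/dg.
have Dg s : J s -> 'D_1 g s = rc ('D_1 gamma s) by move=> Js; exact/derive_rc/dg.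
have eta0 s : J s -> xic ('D_1 gamma s) = 0.
  move=> Js; apply: dot_eq0; have /eqP := gang s Js.
  rewrite /angular_momentum derive1E mulf_eq0 sqrf_eq0 sqrtr_eq0.
  rewrite (gt_eqF (I_gt0 (gS s Js).1)) /= => d0.
  by apply/eqP; rewrite eq_le d0 dot_ge0.
have nul s : J s -> 'D_1 g s ^+ 2 = f (g s) ^+ 2 * 'D_1 u s ^+ 2.
  move=> Js; have [_] := gnull s Js.
  rewrite derive1E /metric eta0// dot0r mulr0 addr0 -Du// -Dg// -/(g s).
  have f0 : f (g s) != 0 by rewrite gt_eqF// f_gt0//; exact: (gS s Js).1.
  move=> H; apply/eqP; rewrite -subr_eq0.
  by rewrite -(mulrI_eq0 _ (mulfI (invr_neq0 f0))) -[X in _ == X]H; apply/eqP; field.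
have u0 s : J s -> 'D_1 u s != 0.
  move=> Js; have [vn0 _] := gnull s Js; apply/negP => /eqP uz; apply: vn0.
  have := nul s Js; rewrite uz expr0n mulr0 => /eqP; rewrite sqrf_eq0 => /eqP gz.
  move: (eta0 s Js) (Du s Js) (Dg s Js); rewrite derive1E uz gz.
  case: ('D_1 gamma s) => [[a b] x]; rewrite /tc /rc /xic /= => -> <- <-.
  by [].
have du s : J s -> differentiable u s by exact: smooth_differentiable.
have inju := derive_neq0_inj iJ du u0.
pose T := u @` J.
pose rho t := rc (gamma (xget 0 [set s | J s /\ u s = t])).
have rhoE s : J s -> rho (u s) = g s.
  move=> Js; rewrite /rho; case: xgetP => [s' _ [Js' us']|/(_ s)[]//].
  by rewrite (inju s' s).
have [oT sT] := smooth_reparam oJ su u0 sg' rhoE.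
exists T, rho; split.
  apply/seteqP; split=> p.
    move=> [s [xi [Js sxi ->]]]; split=> //; first by exists s.
    by rewrite rhoE.
  case: p => -[t r] xi [[s Js /= us] /= rp sxi]; exists s, xi; split=> //.
  by rewrite -[tc _]/(u s) us -[rc (gamma s)]/(g s) -rhoE// us -[r]/(rc ((t, r), xi)) rp.
split.
  split=> //; first by move=> _ [s Js <-]; rewrite rhoE//; exact: (gS s Js).1.
    apply/connected_intervalP; apply: connected_continuous_connected.
      exact/connected_intervalP.
    apply: continuous_in_subspaceT => s /set_mem; exact: smooth_continuous.
  by exists (u s1), s1.
move=> _ [s Js <-].
have Ts : T (u s) by exists s.
have f0 : f (g s) != 0 by rewrite gt_eqF// f_gt0//; exact: (gS s Js).1.
have ch : 'D_1 g s = 'D_1 u s * 'D_1 rho (u s).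
  rewrite -(derive_chain (du s Js) (smooth_differentiable sT Ts)).
  apply: near_eq_derive; apply: filterS (open_nbhs_nbhs (conj oJ Js)) => x Jx.
  by rewrite rhoE.
(* With [r' = t' rho'] the null condition becomes [t' ^ 2 rho' ^ 2 = f ^ 2 t' ^ 2], and [t']
   cancels. *)
have := nul s Js; rewrite ch exprMn mulrC => /(mulIf _) H.
rewrite /causal_gap rhoE// H ?sqrf_eq0 ?u0//.
by field.
Qed.

End Hypersurfaces.

Theorem theorem4p3 (R : realType) (n : nat) (I : set R) (f : R -> R)
    (LS : classS I f) :
  (forall P : set (ambient R n), maximal_sph_sym_photon_surface I f P ->
     forall N, N = future_null_bundle f P \/ N = past_null_bundle f P ->
       (exists k, smooth_submanifold (phase_space n I) k (cotangent_lift I f N)) /\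
       homeomorphic (cotangent_lift I f N)
         (unit_tangent_sphere R n `*` [set: R * R])) /\
  (forall H : set (ambient R n), maximal_principal_null_hypersurface I f H ->
     forall N, N = future_null_bundle f H \/ N = past_null_bundle f H ->
       (exists k, smooth_submanifold (phase_space n I) k (cotangent_lift I f N)) /\
       homeomorphic (cotangent_lift I f N) (sphere R n `*` [set: R * R])).
Proof.
have fn := findim_rV R n; have fnn := findim_prod fn fn.
split=> [P [/(sph_sym_rotation_surface LS) + _]|H [J [gamma [+ _ ->]]]].
  move=> [T [rho [-> [[oT sT TI iT T0] gap]]]] N.
  move=> /(null_bundle_time_oriented LS (rotation_surface_sub TI))[e ee ->].
  apply: (lift_conclusion oT iT T0 fnn (@unit_tangent_sphere_manifold R n)).
  exact: timelike_lift_iso.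
move=> /(principal_rotation_surface LS)[T [rho [-> [[oT sT TI iT T0] gap]]]] N.
move=> /(null_bundle_time_oriented LS (rotation_surface_sub TI))[e ee ->].
apply: (lift_conclusion oT iT T0 fn (@sphere_manifold R n)).
exact: null_lift_iso.
Qed.
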